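(* Let $(X,\Sigma,\mathfrak m)$ be a $\sigma$-finite measure space. Let $\mathscr M$ be a normed $L^\infty(\mathfrak m)$-module. Let $\ell$ be a lifting of $\mathfrak m$ and let $\mathcal L\colon L^\infty(\mathfrak m)\to\mathcal L^\infty(\Sigma)$ be its associated operator. Then there exists a unique couple $(\bar{\mathscr M},\mathscr L)$ (called the $\mathcal L$-lifting of $\mathscr M$), where $\bar{\mathscr M}$ is a normed $\mathcal L^\infty(\Sigma)$-module and $\mathscr L\colon\mathscr M\to\bar{\mathscr M}$ is a linear map, satisfying the following properties: (i) $|\mathscr L(v)|=\mathcal L(|v|)$ for every $v\in\mathscr M$. (ii) The linear subspace $\mathcal V$ of all elements $\bar v\in\bar{\mathscr M}$ of the form $\bar v=\sum_{n\in\mathbb N}\chi_{A_n}\cdot\mathscr L(v_n)$, where $(A_n)_{n\in\mathbb N}\subseteq\Sigma$ is a partition of $X$ and $(v_n)_{n\in\mathbb N}\subseteq\mathscr M$, is dense in $\bar{\mathscr M}$. Uniqueness is intended up to unique isomorphism: given any other couple $(\bar{\mathscr N},\mathscr L')$ with the same properties, there exists a unique $\mathcal L^\infty(\Sigma)$-module isomorphism $\Psi\colon\bar{\mathscr M}\to\bar{\mathscr N}$ preserving the pointwise norm such that $\Psi\circ\mathscr L=\mathscr L'$.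
   Context: Measurable spaces $(X,\Sigma)$ are assumed to satisfy $\{x\}\in\Sigma$ for every $x\in X$. A partition $(A_n)_{n\in\mathbb N}\subseteq\Sigma$ of $X$ is a sequence of pairwise disjoint (possibly empty) sets with union $X$. $\chi_A$ is the characteristic function of $A$. $\mathcal L^\infty(\Sigma)$ is the Banach space and commutative ring of bounded $\Sigma$-measurable functions $X\to\mathbb R$, with norm $\sup_X|\bar f|$. $L^\infty(\mathfrak m)$ is its quotient by $\mathfrak m$-a.e. equality, with the essential supremum norm; $[\,\cdot\,]_{\mathfrak m}$ is the projection map. Lifting: a map $\ell\colon\Sigma\to\Sigma$ such that $\ell(\emptyset)=\emptyset$, $\ell(X)=X$, $\ell(A\Delta B)=\ell(A)\Delta\ell(B)$ and $\ell(A\cap B)=\ell(A)\cap\ell(B)$ for all $A,B\in\Sigma$; $\ell(N)=\emptyset$ whenever $\mathfrak m(N)=0$; and $\mathfrak m(A\Delta\ell(A))=0$ for all $A\in\Sigma$. Its associated operator $\mathcal L\colon L^\infty(\mathfrak m)\to\mathcal L^\infty(\Sigma)$ is the unique linear continuous operator with $\mathcal L([\chi_A]_{\mathfrak m})=\chi_{\ell(A)}$ for every $A\in\Sigma$. Normed $L^\infty(\mathfrak m)$-module: a couple $(\mathscr M,|\cdot|)$ where $\mathscr M$ is an algebraic $L^\infty(\mathfrak m)$-module and $|\cdot|\colon\mathscr M\to L^\infty(\mathfrak m)$ (the pointwise norm) satisfies, $\mathfrak m$-a.e., $|v|\ge0$ with equality iff $v=0$, $|v+w|\le|v|+|w|$,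 $|f\cdot v|=|f||v|$; the glueing property holds: for every partition $(A_n)_n\subseteq\Sigma$ of $X$ and $(v_n)_n\subseteq\mathscr M$ with $\sup_n\operatorname{ess\,sup}_{A_n}|v_n|<\infty$ there is a (unique) $v\in\mathscr M$ with $[\chi_{A_n}]_{\mathfrak m}\cdot v=[\chi_{A_n}]_{\mathfrak m}\cdot v_n$ for all $n$; and the norm $\|v\|_{\mathscr M}:=\||v|\|_{L^\infty(\mathfrak m)}$ is complete. Normed $\mathcal L^\infty(\Sigma)$-module: a couple $(\bar{\mathscr M},|\cdot|)$ where $\bar{\mathscr M}$ is an algebraic $\mathcal L^\infty(\Sigma)$-module and $|\cdot|\colon\bar{\mathscr M}\to\mathcal L^\infty(\Sigma)$ satisfies, everywhere on $X$, $|\bar v|\ge0$ with equality iff $\bar v=0$, $|\bar v+\bar w|\le|\bar v|+|\bar w|$, $|\bar f\cdot\bar v|=|\bar f||\bar v|$; the glueing property holds: for every partition $(A_n)_n\subseteq\Sigma$ of $X$ and $(\bar v_n)_n\subseteq\bar{\mathscr M}$ with $\sup_n\sup_{A_n}|\bar v_n|<\infty$ there is a (unique) $\bar v\in\bar{\mathscr M}$, denoted $\sum_n\chi_{A_n}\cdot\bar v_n$, with $\chi_{A_n}\cdot\bar v=\chi_{A_n}\cdot\bar v_n$ for all $n$; and the norm $\|\bar v\|_{\bar{\mathscr M}}:=\sup_X|\bar v|$ is complete. In (ii), $\bar v=\sum_n\chi_{A_n}\cdot\mathscr L(v_n)$ means $\chi_{A_n}\cdot\bar v=\chi_{A_n}\cdot\mathscr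 L(v_n)$ for all $n$; density is with respect to $\|\cdot\|_{\bar{\mathscr M}}$. *)

(* Defs.v *)
From HB Require Import structures.
From mathcomp Require Import all_boot all_order all_algebra.
From mathcomp Require Import all_classical all_reals all_analysis.
From mathcomp Require Import measurable_realfun ess_sup_inf.

Set Implicit Arguments.
Unset Strict Implicit.
Unset Printing Implicit Defensive.

Import Order.TTheory GRing.Theory Num.Theory.
Import numFieldNormedType.Exports.

Local Open Scope classical_set_scope.
Local Open Scope quotient_scope.
Local Open Scope ring_scope.

Section BoundedMeasurable.
Context (d : measure_display) (X : measurableType d) (R : realType).

Definition bmfun_pred : {pred X -> R} :=
  mem [set f : X -> R | measurable_fun [set: X] f /\ bounded_fun f].

Record bmfun := BMFun {
  bmfun_fun :> X -> R;
  bmfunP : bmfun_fun \in bmfun_pred }.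

HB.instance Definition _ := [isSub for bmfun_fun].
HB.instance Definition _ := [Choice of bmfun by <:].

Lemma bounded_funP (f : X -> R) :
  bounded_fun f <-> exists M : R, forall x, `|f x| <= M.
Proof.
split=> [[M [_ Mf]]|[M Mf]].
  by exists (M + 1) => x; apply: (Mf (M + 1)) => //; rewrite ltrDl.
exists M; split; first exact: num_real.
by move=> N MN x _ /=; rewrite (le_trans (Mf x))// ltW.
Qed.

Lemma bmfun_predE (f : X -> R) : (f \in bmfun_pred) <->
  measurable_fun [set: X] f /\ exists M : R, forall x, `|f x| <= M.
Proof.
rewrite inE; split=> -[mf bf]; split=> //; exact/bounded_funP.
Qed.

Lemma bmfun_subring_closed : subring_closed bmfun_pred.
Proof.
split.
- by apply/bmfun_predE; split; [exact: measurable_cst|exists 1 => x; rewrite normr1].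
- move=> f g /bmfun_predE[mf [M Mf]] /bmfun_predE[mg [N Ng]].
  apply/bmfun_predE; split; first exact: measurable_funB.
  by exists (M + N) => x; rewrite (le_trans (ler_normB _ _))// lerD.
- move=> f g /bmfun_predE[mf [M Mf]] /bmfun_predE[mg [N Ng]].
  apply/bmfun_predE; split; first exact: measurable_funM.
  by exists (M * N) => x; rewrite normrM ler_pM.
Qed.

HB.instance Definition _ :=
  GRing.isSubringClosed.Build _ bmfun_pred bmfun_subring_closed.
HB.instance Definition _ := [SubChoice_isSubComNzRing of bmfun by <:].

Lemma bmfun_scaler_closed : scaler_closed bmfun_pred.
Proof.
move=> a f /bmfun_predE[mf [M Mf]]; apply/bmfun_predE; split.
  exact: measurable_funM.
by exists (`|a| * M) => x; rewrite normrM ler_wpM2l.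
Qed.

HB.instance Definition _ :=
  GRing.isScaleClosed.Build _ _ bmfun_pred bmfun_scaler_closed.
HB.instance Definition _ := [SubZmodule_isSubLmodule of bmfun by <:].

Implicit Types f g : bmfun.

Lemma bmfun_eqP f g : f = g <-> forall x, f x = g x.
Proof. by split=> [->//|fg]; apply/val_inj/funext. Qed.

Lemma bmfun0E x : (0 : bmfun) x = 0. Proof. by []. Qed.
Lemma bmfun1E x : (1 : bmfun) x = 1. Proof. by []. Qed.
Lemma bmfunNE f x : (- f) x = - f x. Proof. by []. Qed.
Lemma bmfunDE f g x : (f + g) x = f x + g x. Proof. by []. Qed.
Lemma bmfunME f g x : (f * g) x = f x * g x. Proof. by []. Qed.
Lemma bmfunZE (a : R) f x : (a *: f) x = a * f x. Proof. by []. Qed.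

Lemma bmfun_measurable f : measurable_fun [set: X] f.
Proof. by have /bmfun_predE[] := bmfunP f. Qed.

Lemma bmfun_bounded f : exists M : R, forall x, `|f x| <= M.
Proof. by have /bmfun_predE[] := bmfunP f. Qed.

Lemma bmfun_abs_subproof f : (fun x => `|f x|) \in bmfun_pred.
Proof.
apply/bmfun_predE; split; first exact/measurableT_comp/bmfun_measurable.
by have [M Mf] := bmfun_bounded f; exists M => x; rewrite normr_id.
Qed.
Definition bmfun_abs f : bmfun := BMFun (bmfun_abs_subproof f).

Lemma bmfun_indic_subproof (A : set X) (mA : measurable A) :
  (\1_A : X -> R) \in bmfun_pred.
Proof.
apply/bmfun_predE; split; first exact: measurable_indic.
by exists 1 => x; rewrite indicE; case: (_ \in _); rewrite ?normr1 ?normr0.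
Qed.
Definition bmfun_indic (A : set X) (mA : measurable A) : bmfun :=
  BMFun (bmfun_indic_subproof mA).

Definition sup_norm f : R := sup [set `|f x| | x in [set: X]].

Lemma sup_norm_ub f x : `|f x| <= sup_norm f.
Proof.
have [M Mf] := bmfun_bounded f.
apply: sup_upper_bound; last by exists x.
by split; [exists `|f x|, x|exists M => _ [y _ <-]].
Qed.

Lemma sup_norm_le f (M : R) : (forall x, `|f x| <= M) -> sup_norm f <= M.
Proof.
by move=> Mf; apply: ge_sup => [|_ [y _ <-]//]; exists `|f point|, point.
Qed.

Lemma sup_norm_ge0 f : 0 <= sup_norm f.
Proof. exact: le_trans (sup_norm_ub f point). Qed.

Lemma sup_normD f g : sup_norm (f + g) <= sup_norm f + sup_norm g.
Proof.
apply: sup_norm_le => x.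
by rewrite bmfunDE (le_trans (ler_normD _ _))// lerD// sup_norm_ub.
Qed.

Lemma sup_normZ (a : R) f : sup_norm (a *: f) = `|a| * sup_norm f.
Proof.
have le b g : sup_norm (b *: g) <= `|b| * sup_norm g.
  by apply: sup_norm_le => x; rewrite bmfunZE normrM ler_wpM2l// sup_norm_ub.
apply/eqP; rewrite eq_le le/=.
have [->|a0] := eqVneq a 0; first by rewrite normr0 mul0r sup_norm_ge0.
rewrite -ler_pdivlMl ?normr_gt0// -normfV.
by rewrite (le_trans _ (le _ _))// scalerA mulVf// scale1r.
Qed.

Lemma sup_norm0_eq0 f : sup_norm f = 0 -> f = 0.
Proof.
move=> f0; apply/bmfun_eqP => x; apply/eqP.
by rewrite -normr_le0 -f0 sup_norm_ub.
Qed.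

HB.instance Definition _ :=
  Lmodule_isNormed.Build R bmfun sup_normD sup_normZ sup_norm0_eq0.

End BoundedMeasurable.

Section Linfinity.
Context (d : measure_display) (X : measurableType d) (R : realType).
Variable m : {measure set X -> \bar R}.
Implicit Types f g h : bmfun X R.

Definition bmfun_ae_eq f g : bool := `[< {ae m, forall x, f x = g x} >].

Lemma bmfun_ae_eq_is_equiv : equiv_class_of bmfun_ae_eq.
Proof.
split=> [f|f g|g f h].
- by apply/asboolP; exact: nearW.
- by apply/asboolP/asboolP; apply: filterS => x ->.
- move=> /asboolP fg /asboolP gh; apply/asboolP.
  by apply: filterS2 fg gh => x -> ->.
Qed.

Canonical bmfun_ae_eq_equiv := EquivRelPack bmfun_ae_eq_is_equiv.
Canonical bmfun_ae_eq_encModRel := defaultEncModRel bmfun_ae_eq.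

Definition Linf := {eq_quot bmfun_ae_eq}.
HB.instance Definition _ := Choice.on Linf.
HB.instance Definition _ : EqQuotient _ bmfun_ae_eq Linf := EqQuotient.on Linf.

Definition Linf_class (f : bmfun X R) : Linf := \pi_Linf f.

Lemma Linf_classP f g :
  Linf_class f = Linf_class g <-> {ae m, forall x, f x = g x}.
Proof.
split=> [/eqP|fg]; first by rewrite /Linf_class eqmodE => /asboolP.
by apply/eqP; rewrite /Linf_class eqmodE; exact/asboolP.
Qed.

Lemma Linf_reprK (F : Linf) : Linf_class (repr F) = F.
Proof. exact: reprK. Qed.

Lemma Linf_reprP f : {ae m, forall x, repr (Linf_class f) x = f x}.
Proof. by apply/Linf_classP; rewrite Linf_reprK. Qed.

Definition Linf_add (F G : Linf) : Linf := Linf_class (repr F + repr G).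
Definition Linf_opp (F : Linf) : Linf := Linf_class (- repr F).
Definition Linf_mul (F G : Linf) : Linf := Linf_class (repr F * repr G).
Definition Linf_scale (a : R) (F : Linf) : Linf := Linf_class (a *: repr F).
Definition Linf_abs (F : Linf) : Linf := Linf_class (bmfun_abs (repr F)).

Lemma Linf_addE f g : Linf_add (Linf_class f) (Linf_class g) = Linf_class (f + g).
Proof.
by apply/Linf_classP; apply: filterS2 (Linf_reprP f) (Linf_reprP g) => x; rewrite !bmfunDE => -> ->.
Qed.

Lemma Linf_oppE f : Linf_opp (Linf_class f) = Linf_class (- f).
Proof.
by apply/Linf_classP; apply: filterS (Linf_reprP f) => x; rewrite !bmfunNE => ->.
Qed.

Lemma Linf_mulE f g : Linf_mul (Linf_class f) (Linf_class g) = Linf_class (f * g).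
Proof.
by apply/Linf_classP; apply: filterS2 (Linf_reprP f) (Linf_reprP g) => x; rewrite !bmfunME => -> ->.
Qed.

Lemma Linf_scaleE a f : Linf_scale a (Linf_class f) = Linf_class (a *: f).
Proof.
by apply/Linf_classP; apply: filterS (Linf_reprP f) => x; rewrite !bmfunZE => ->.
Qed.

Lemma Linf_absE f : Linf_abs (Linf_class f) = Linf_class (bmfun_abs f).
Proof.
by apply/Linf_classP; apply: filterS (Linf_reprP f) => x /= ->.
Qed.

Let LinfW (P : Linf -> Prop) : (forall f, P (Linf_class f)) -> forall F, P F.
Proof. by move=> Pf F; rewrite -[F]Linf_reprK. Qed.

Let Linf_addA : associative Linf_add.
Proof. by do 3![elim/LinfW=> ?]; rewrite !Linf_addE addrA. Qed.
Let Linf_addC : commutative Linf_add.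
Proof. by do 2![elim/LinfW=> ?]; rewrite !Linf_addE addrC. Qed.
Let Linf_add0 : left_id (Linf_class 0) Linf_add.
Proof. by elim/LinfW=> ?; rewrite !Linf_addE add0r. Qed.
Let Linf_addN : left_inverse (Linf_class 0) Linf_opp Linf_add.
Proof. by elim/LinfW=> ?; rewrite Linf_oppE !Linf_addE addNr. Qed.

HB.instance Definition _ :=
  GRing.isZmodule.Build Linf Linf_addA Linf_addC Linf_add0 Linf_addN.

Let Linf_mulA : associative Linf_mul.
Proof. by do 3![elim/LinfW=> ?]; rewrite !Linf_mulE mulrA. Qed.
Let Linf_mulC : commutative Linf_mul.
Proof. by do 2![elim/LinfW=> ?]; rewrite !Linf_mulE mulrC. Qed.
Let Linf_mul1 : left_id (Linf_class 1) Linf_mul.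
Proof. by elim/LinfW=> ?; rewrite !Linf_mulE mul1r. Qed.
Let Linf_mulDl : left_distributive Linf_mul +%R.
Proof.
do 3![elim/LinfW=> ?].
by rewrite /GRing.add/= !(Linf_mulE, Linf_addE) mulrDl.
Qed.

HB.instance Definition _ := GRing.Zmodule_isComPzRing.Build Linf
  Linf_mulA Linf_mulC Linf_mul1 Linf_mulDl.

Lemma Linf_class0 : Linf_class 0 = 0. Proof. by []. Qed.
Lemma Linf_class1 : Linf_class 1 = 1. Proof. by []. Qed.
Lemma Linf_classD f g : Linf_class (f + g) = Linf_class f + Linf_class g.
Proof. by rewrite -Linf_addE. Qed.
Lemma Linf_classN f : Linf_class (- f) = - Linf_class f.
Proof. by rewrite -Linf_oppE. Qed.
Lemma Linf_classM f g : Linf_class (f * g) = Linf_class f * Linf_class g.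
Proof. by rewrite -Linf_mulE. Qed.

Let Linf_scaleA a b F : Linf_scale a (Linf_scale b F) = Linf_scale (a * b) F.
Proof. by elim/LinfW: F => f; rewrite !Linf_scaleE scalerA. Qed.
Let Linf_scale1 : left_id 1 Linf_scale.
Proof. by elim/LinfW=> f; rewrite !Linf_scaleE scale1r. Qed.
Let Linf_scaleDr : right_distributive Linf_scale +%R.
Proof.
move=> a; do 2![elim/LinfW=> ?].
by rewrite -Linf_classD !Linf_scaleE scalerDr Linf_classD.
Qed.
Let Linf_scaleDl F : {morph Linf_scale^~ F : a b / a + b}.
Proof.
by move=> a b; elim/LinfW: F => f; rewrite !Linf_scaleE scalerDl Linf_classD.
Qed.

HB.instance Definition _ := GRing.Zmodule_isLmodule.Build R Linf
  Linf_scaleA Linf_scale1 Linf_scaleDr Linf_scaleDl.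

Lemma Linf_classZ a f : Linf_class (a *: f) = a *: Linf_class f.
Proof. by rewrite -Linf_scaleE. Qed.

Lemma Linf_reprD (F G : Linf) :
  {ae m, forall x, repr (F + G) x = repr F x + repr G x}.
Proof. exact: Linf_reprP. Qed.

Lemma Linf_reprM (F G : Linf) :
  {ae m, forall x, repr (F * G) x = repr F x * repr G x}.
Proof. exact: Linf_reprP. Qed.

Lemma Linf_reprZ a (F : Linf) :
  {ae m, forall x, repr (a *: F) x = a * repr F x}.
Proof. exact: Linf_reprP. Qed.

Lemma Linf_repr_abs (F : Linf) :
  {ae m, forall x, repr (Linf_abs F) x = `|repr F x|}.
Proof. exact: Linf_reprP. Qed.

Lemma Linf_eqP (F G : Linf) : F = G <-> {ae m, forall x, repr F x = repr G x}.
Proof. by rewrite -Linf_classP !Linf_reprK. Qed.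

Definition Linf_le (F G : Linf) : Prop :=
  {ae m, forall x, repr F x <= repr G x}.

(* If [m] is the zero measure, [ess_sup] is [-oo], whose [fine] is 0. *)
Definition Linf_norm (F : Linf) : R :=
  fine (ess_sup m (fun x => `|repr F x|%:E)).

Lemma Linf_norm_ub (F : Linf) : {ae m, forall x, `|repr F x| <= Linf_norm F}.
Proof.
rewrite /Linf_norm; pose g x := `|repr F x|%:E; rewrite -/g.
have := ess_sup_ge m g; case E : (ess_sup m g) => [r| |] h.
- by apply: filterS h => x; rewrite lee_fin.
- have [M Mf] := bmfun_bounded (repr F).
  have : (ess_sup m g <= M%:E)%E.
    by apply/ess_supP; apply: nearW => x; rewrite lee_fin.
  by rewrite E leye_eq.
- by apply: filterS h => x; rewrite leeNy_eq.
Qed.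

Lemma Linf_norm_ge0 (F : Linf) : 0 <= Linf_norm F.
Proof.
have := Linf_norm_ub F; rewrite /Linf_norm.
case E : (ess_sup m _) => [r| |] //= h.
rewrite leNgt; apply/negP => r0.
suff : ess_sup m (fun x => `|repr F x|%:E) = -oo%E by rewrite E.
apply/ess_sup_eqNyP; apply: filterS h => x.
by move=> /le_lt_trans/(_ r0); rewrite normr_lt0.
Qed.

Lemma Linf_norm_le (F : Linf) (M : R) : 0 <= M ->
  {ae m, forall x, `|repr F x| <= M} -> Linf_norm F <= M.
Proof.
move=> M0 h; have : (ess_sup m (fun x => `|repr F x|%:E) <= M%:E)%E.
  by apply/ess_supP; apply: filterS h => x; rewrite lee_fin.
by rewrite /Linf_norm; case: (ess_sup m _).
Qed.

Lemma Linf_normD (F G : Linf) : Linf_norm (F + G) <= Linf_norm F + Linf_norm G.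
Proof.
apply: Linf_norm_le; first by rewrite addr_ge0// Linf_norm_ge0.
apply: filterS3 (Linf_norm_ub F) (Linf_norm_ub G) (Linf_reprD F G) => x h1 h2 ->.
by rewrite (le_trans (ler_normD _ _))// lerD.
Qed.

Lemma Linf_normZ (a : R) (F : Linf) : Linf_norm (a *: F) = `|a| * Linf_norm F.
Proof.
have le b G : Linf_norm (b *: G) <= `|b| * Linf_norm G.
  apply: Linf_norm_le; first by rewrite mulr_ge0// Linf_norm_ge0.
  apply: filterS2 (Linf_norm_ub G) (Linf_reprZ b G) => x h ->.
  by rewrite normrM ler_wpM2l.
apply/eqP; rewrite eq_le le/=.
have [->|a0] := eqVneq a 0; first by rewrite normr0 mul0r Linf_norm_ge0.
rewrite -ler_pdivlMl ?normr_gt0// -normfV.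
by rewrite (le_trans _ (le _ _))// scalerA mulVf// scale1r.
Qed.

Lemma Linf_norm0_eq0 (F : Linf) : Linf_norm F = 0 -> F = 0.
Proof.
move=> F0; apply/Linf_eqP; have := Linf_norm_ub F; rewrite F0 => h.
apply: filterS2 h (Linf_reprP 0) => x.
by rewrite normr_le0 => /eqP -> ->.
Qed.

HB.instance Definition _ :=
  Lmodule_isNormed.Build R Linf Linf_normD Linf_normZ Linf_norm0_eq0.

End Linfinity.

Section Partition.
Context (d : measure_display) (X : measurableType d).

(* Unlike in the library's [partition], blocks may be empty. *)
Record mpartition := MPartition {
  block :> nat -> set X;
  block_measurable : forall n, measurable (block n);
  block_trivIset : trivIset [set: nat] block;
  block_bigcup : \bigcup_n block n = [set: X] }.

End Partition.

Section EssSupOn.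
Context (d : measure_display) (X : measurableType d) (R : realType).

(* On an empty (resp. negligible) set these are [-oo]. *)
Definition sup_on (A : set X) (f : bmfun X R) : \bar R :=
  ereal_sup [set (f x)%:E | x in A].

Definition ess_sup_on (m : {measure set X -> \bar R}) (A : set X)
    (mA : measurable A) (F : Linf m) : \bar R :=
  ess_sup (mrestr m mA) (fun x => (repr F x)%:E).

End EssSupOn.

HB.mixin Record isLinfPointwiseNormed (d : measure_display)
    (X : measurableType d) (R : realType) (m : {measure set X -> \bar R}) M
    & GRing.Lmodule (Linf m) M := {
  Linf_pnorm : M -> Linf m;
  Linf_pnorm_ge0 : forall v, Linf_le 0 (Linf_pnorm v);
  Linf_pnorm_eq0 : forall v, Linf_pnorm v = 0 <-> v = 0;
  Linf_pnormD : forall v w,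
    Linf_le (Linf_pnorm (v + w)) (Linf_pnorm v + Linf_pnorm w);
  Linf_pnormZ : forall (f : Linf m) v,
    Linf_pnorm (f *: v) = Linf_abs f * Linf_pnorm v }.

#[short(type=LinfPNormedType)]
HB.structure Definition LinfPointwiseNormed (d : measure_display)
    (X : measurableType d) (R : realType) (m : {measure set X -> \bar R}) :=
  { M of GRing.Lmodule (Linf m) M & isLinfPointwiseNormed d X R m M }.

HB.mixin Record isBmfunPointwiseNormed (d : measure_display)
    (X : measurableType d) (R : realType) M
    & GRing.Lmodule (bmfun X R) M := {
  bm_pnorm : M -> bmfun X R;
  bm_pnorm_ge0 : forall v x, 0 <= bm_pnorm v x;
  bm_pnorm_eq0 : forall v, (forall x, bm_pnorm v x = 0) <-> v = 0;
  bm_pnormD : forall v w x,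
    bm_pnorm (v + w) x <= bm_pnorm v x + bm_pnorm w x;
  bm_pnormZ : forall (f : bmfun X R) v x,
    bm_pnorm (f *: v) x = `|f x| * bm_pnorm v x }.

#[short(type=bmfunPNormedType)]
HB.structure Definition BmfunPointwiseNormed (d : measure_display)
    (X : measurableType d) (R : realType) :=
  { M of GRing.Lmodule (bmfun X R) M & isBmfunPointwiseNormed d X R M }.

(* A module over [Linf m] (resp. [bmfun X R]) is a real vector space through
   the constant functions [a *: 1], and carries the norm of the pointwise norm.
   These structures are put on the aliases [Linf_normed M] and [bm_normed M],
   as [M] itself already has a module structure over another ring. *)
Section LinfNormed.
Context (d : measure_display) (X : measurableType d) (R : realType).
Variables (m : {measure set X -> \bar R}) (M : LinfPNormedType m).
Local Notation norm v := `|(Linf_pnorm v : Linf m)|.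

Lemma Linf_mul_algl (a : R) (F : Linf m) : (a *: (1 : Linf m)) * F = a *: F.
Proof.
rewrite -[F]Linf_reprK -(Linf_class1 m) -!Linf_classZ -Linf_classM.
by congr Linf_class; apply/bmfun_eqP => x; rewrite bmfunME !bmfunZE mulr1.
Qed.

Lemma Linf_abs_alg (a : R) : Linf_abs (a *: (1 : Linf m)) = `|a| *: (1 : Linf m).
Proof.
rewrite -(Linf_class1 m) -!Linf_classZ Linf_absE; congr Linf_class.
by apply/bmfun_eqP => x; rewrite /= normrM normr1.
Qed.

Lemma Linf_norm_mono (F G : Linf m) : Linf_le 0 F -> Linf_le F G ->
  `|F| <= `|G|.
Proof.
move=> F0 FG; apply: Linf_norm_le; first exact: Linf_norm_ge0.
have {}F0 : {ae m, forall x, 0 <= repr F x}.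
  by apply: filterS2 F0 (Linf_reprP m 0) => x + h; rewrite h.
apply: filterS3 F0 FG (Linf_norm_ub G) => x h1 h2 h3.
by rewrite ger0_norm// (le_trans h2)// (le_trans (ler_norm _)).
Qed.

Definition Linf_normed : Type := M.
HB.instance Definition _ := GRing.Zmodule.copy Linf_normed M.

Let scale (a : R) (v : Linf_normed) : Linf_normed :=
  (a *: (1 : Linf m)) *: (v : M).
Let scaleA a b v : scale a (scale b v) = scale (a * b) v.
Proof. by rewrite /scale scalerA Linf_mul_algl scalerA. Qed.
Let scale1 : left_id 1 scale.
Proof. by move=> v; rewrite /scale !scale1r. Qed.
Let scaleDr : right_distributive scale +%R.
Proof. by move=> a v w; rewrite /scale scalerDr. Qed.
Let scaleDl v : {morph scale^~ v : a b / a + b}.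
Proof. by move=> a b; rewrite /scale !scalerDl. Qed.

HB.instance Definition _ := GRing.Zmodule_isLmodule.Build R Linf_normed
  scaleA scale1 scaleDr scaleDl.

Let normD (v w : Linf_normed) : norm (v + w) <= norm v + norm w.
Proof.
rewrite (le_trans _ (ler_normD _ _))//.
by apply: Linf_norm_mono; [exact: Linf_pnorm_ge0|exact: Linf_pnormD].
Qed.
Let normZ (a : R) (v : Linf_normed) : norm (a *: v) = `|a| * norm v.
Proof.
by rewrite Linf_pnormZ Linf_abs_alg Linf_mul_algl normrZ normr_id.
Qed.
Let norm0_eq0 (v : Linf_normed) : norm v = 0 -> v = 0.
Proof. by move=> /normr0_eq0/Linf_pnorm_eq0. Qed.

HB.instance Definition _ :=
  Lmodule_isNormed.Build R Linf_normed normD normZ norm0_eq0.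

End LinfNormed.

Section BmfunNormed.
Context (d : measure_display) (X : measurableType d) (R : realType).
Variable M : bmfunPNormedType X R.
Local Notation norm v := `|(bm_pnorm v : bmfun X R)|.

Definition bm_normed : Type := M.
HB.instance Definition _ := GRing.Zmodule.copy bm_normed M.

Let scale (a : R) (v : bm_normed) : bm_normed :=
  (a *: (1 : bmfun X R)) *: (v : M).
Let scaleA a b v : scale a (scale b v) = scale (a * b) v.
Proof.
rewrite /scale scalerA; congr (_ *: _).
by apply/bmfun_eqP => x; rewrite bmfunME !bmfunZE !mulr1.
Qed.
Let scale1 : left_id 1 scale.
Proof. by move=> v; rewrite /scale !scale1r. Qed.
Let scaleDr : right_distributive scale +%R.
Proof. by move=> a v w; rewrite /scale scalerDr. Qed.
Let scaleDl v : {morph scale^~ v : a b / a + b}.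
Proof. by move=> a b; rewrite /scale !scalerDl. Qed.

HB.instance Definition _ := GRing.Zmodule_isLmodule.Build R bm_normed
  scaleA scale1 scaleDr scaleDl.

Let normD (v w : bm_normed) : norm (v + w) <= norm v + norm w.
Proof.
rewrite (le_trans _ (ler_normD _ _))//; apply: sup_norm_le => x.
rewrite ger0_norm ?bm_pnorm_ge0// (le_trans (bm_pnormD _ _ _))//.
rewrite (le_trans (ler_norm _))//.
exact: (sup_norm_ub (bm_pnorm v + bm_pnorm w) x).
Qed.
Let normZ (a : R) (v : bm_normed) : norm (a *: v) = `|a| * norm v.
Proof.
rewrite -[`|a|]normr_id -normrZ; congr (`|_|); apply/bmfun_eqP => x.
by rewrite bm_pnormZ !bmfunZE mulr1.
Qed.
Let norm0_eq0 (v : bm_normed) : norm v = 0 -> v = 0.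
Proof. by move=> /normr0_eq0 v0; apply/bm_pnorm_eq0 => x; rewrite v0. Qed.

HB.instance Definition _ :=
  Lmodule_isNormed.Build R bm_normed normD normZ norm0_eq0.

End BmfunNormed.

HB.mixin Record isNormedLinfModule (d : measure_display)
    (X : measurableType d) (R : realType) (m : {measure set X -> \bar R}) M
    & @LinfPointwiseNormed d X R m M := {
  Linf_glueing : forall (A : mpartition X) (v : nat -> M),
    (ereal_sup (range (fun n =>
       ess_sup_on (block_measurable A n) (Linf_pnorm (v n)))) < +oo)%E ->
    exists! w : M, forall n,
      Linf_class m (bmfun_indic R (block_measurable A n)) *: w =
      Linf_class m (bmfun_indic R (block_measurable A n)) *: v n;
  Linf_complete : forall u : nat -> Linf_normed M,
    cauchy (u @ \oo) -> cvgn u }.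

#[short(type=normedLinfModuleType)]
HB.structure Definition NormedLinfModule (d : measure_display)
    (X : measurableType d) (R : realType) (m : {measure set X -> \bar R}) :=
  { M of @LinfPointwiseNormed d X R m M & isNormedLinfModule d X R m M }.

HB.mixin Record isNormedBmfunModule (d : measure_display)
    (X : measurableType d) (R : realType) M
    & @BmfunPointwiseNormed d X R M := {
  bm_glueing : forall (A : mpartition X) (v : nat -> M),
    (ereal_sup (range (fun n => sup_on (A n) (bm_pnorm (v n)))) < +oo)%E ->
    exists! w : M, forall n,
      bmfun_indic R (block_measurable A n) *: w =
      bmfun_indic R (block_measurable A n) *: v n;
  bm_complete : forall u : nat -> bm_normed M,
    cauchy (u @ \oo) -> cvgn u }.

#[short(type=normedBmfunModuleType)]
HB.structure Definition NormedBmfunModule (d : measure_display)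
    (X : measurableType d) (R : realType) :=
  { M of @BmfunPointwiseNormed d X R M & isNormedBmfunModule d X R M }.

Section Lifting.
Context (d : measure_display) (X : measurableType d) (R : realType).
Variable m : {measure set X -> \bar R}.

(* Only the values of [ell] on measurable sets are constrained. *)
Record lifting := Lifting {
  lift_set :> set X -> set X;
  lift_measurable : forall A, measurable A -> measurable (lift_set A);
  lift_set0 : lift_set set0 = set0;
  lift_setT : lift_set [set: X] = [set: X];
  lift_setY : forall A B, measurable A -> measurable B ->
    lift_set (A `+` B) = lift_set A `+` lift_set B;
  lift_setI : forall A B, measurable A -> measurable B ->
    lift_set (A `&` B) = lift_set A `&` lift_set B;
  lift_null : forall N, measurable N -> m N = 0 -> lift_set N = set0;
  lift_ae : forall A, measurable A -> m (A `+` lift_set A) = 0 }.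

Definition associated_operator (ell : lifting)
    (L : {linear Linf m -> bmfun X R}) : Prop :=
  continuous L /\
  forall (A : set X) (mA : measurable A),
    L (Linf_class m (bmfun_indic R mA)) =
    bmfun_indic R (lift_measurable ell mA).

Variables (M : normedLinfModuleType m) (N : normedBmfunModuleType X R).
Variable LL : {linear Linf_normed M -> bm_normed N}.

Definition lifted_span : set (bm_normed N) :=
  [set w | exists (A : mpartition X) (v : nat -> M), forall n,
    bmfun_indic R (block_measurable A n) *: (w : N) =
    bmfun_indic R (block_measurable A n) *: (LL (v n) : N)].

Definition is_module_lifting (L : {linear Linf m -> bmfun X R}) : Prop :=
  (forall v : M, bm_pnorm (LL v : N) = L (Linf_pnorm v)) /\
  dense lifted_span.

End Lifting.

Section Isomorphism.
Context (d : measure_display) (X : measurableType d) (R : realType).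
Variables M N : normedBmfunModuleType X R.

Definition pnorm_isomorphism (Psi : M -> N) : Prop :=
  [/\ linear Psi, bijective Psi & forall v, bm_pnorm (Psi v) = bm_pnorm v].

End Isomorphism.

(* Main.v *)
Require Import Defs.
From HB Require Import structures.
From mathcomp Require Import all_boot all_order all_algebra.
From mathcomp Require Import all_classical all_reals all_analysis.
From mathcomp Require Import measurable_realfun ess_sup_inf ring lra.

Set Implicit Arguments.
Unset Strict Implicit.
Unset Printing Implicit Defensive.

Import Order.TTheory GRing.Theory Num.Theory.
Import numFieldNormedType.Exports.

Local Open Scope classical_set_scope.
Local Open Scope ring_scope.

(** The operator [L] is positive, so [v |-> L |v| (x)] is for every [x : X] a
    seminorm [p_x] on [M]. Let [D_x] be the set of linear functionals on [M]
    dominated by [p_x]. By Hahn-Banach, [M / ker p_x] embeds isometrically in the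
    bounded functions on [D_x], hence sections of the bundle of completed fibres
    can be realised as functions [s x phi], with [phi] in [D_x], and no quotient
    or completion has to be formed. The lifting of [M] consists of the bounded
    sections that can be approximated uniformly by [x |-> w x] in the fibres, for
    countably valued measurable [w : X -> M].

    For uniqueness, the isomorphism relates [s] and [t] if, for every [e > 0], they
    are within [e] of the images of one countably valued [w : X -> M]. Both couples
    have the same seminorms [p_x], so this relation preserves the pointwise norm;
    being linear, it is a function, and it is total by glueing and completeness. *)

(** * Sublinear functionals and Hahn-Banach through minimal ones *)

Section HahnBanach.
Context (R : realType) (V : lmodType R).
Implicit Types (p q : V -> R) (u v : V).

(** An inequality suffices for homogeneity: for [t > 0] the reverse one follows by scaling with
    [t^-1]. *)
Definition sublinear q :=
  (forall u v, q (u + v) <= q u + q v) /\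
  (forall t v, 0 <= t -> q (t *: v) <= t * q v).

Lemma sublinear0 q : sublinear q -> q 0 = 0.
Proof.
move=> [qD qZ]; apply/eqP; rewrite eq_le; apply/andP; split.
  by have := qZ 0 0 (lexx _); rewrite scaler0 mul0r.
by have := qD 0 0; rewrite addr0 -lerBlDr subrr.
Qed.

Lemma sublinearN q u : sublinear q -> - q (- u) <= q u.
Proof.
move=> sq; have := sq.1 u (- u); rewrite subrr (sublinear0 sq).
by rewrite -lerBlDr sub0r.
Qed.

(* [q_v = shrink q v] is a sublinear functional below [q] with
   [q_v (- v) = - q v]: a minimal sublinear functional is thus odd. *)
Definition shrink q v u : R := inf [set q (u + t *: v) - t * q v | t in `[0, +oo[].

(** By subadditivity [q (t *: v) <= q (u + t *: v) + q (- u)], and scaling by [t^-1] gives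
    [t * q v <= q (t *: v)]. The bound keeps [inf] in [shrink] from being a default value. *)
Lemma shrink_has_lbound q v u : sublinear q ->
  lbound [set q (u + t *: v) - t * q v | t in `[0, +oo[] (- q (- u)).
Proof.
move=> sq _ [t + <-]; rewrite /= in_itv/= andbT => t0.
have := sq.1 (u + t *: v) (- u); rewrite addrAC subrr add0r => h1.
have := sq.2 t v t0; have [->|t_neq0] := eqVneq t 0.
  by rewrite scale0r addr0 mul0r subr0 sublinearN.
have := sq.2 t^-1 (t *: v); rewrite scalerA mulVf// scale1r invr_ge0 => /(_ t0).
rewrite ler_pdivlMl ?lt_neqAle ?(eq_sym 0) ?t_neq0// => h2 h3.
by rewrite lerBrDr; lra.
Qed.

Lemma shrink_le q v u t : sublinear q -> 0 <= t ->
  shrink q v u <= q (u + t *: v) - t * q v.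
Proof.
move=> sq t0; apply: ge_inf; first by exists (- q (- u)); exact: shrink_has_lbound.
by exists t => //=; rewrite in_itv/= andbT.
Qed.

Lemma shrink_ge q v u (c : R) :
  (forall t, 0 <= t -> c <= q (u + t *: v) - t * q v) ->
  c <= shrink q v u.
Proof.
move=> h; apply: lb_le_inf.
  by exists (q (u + 0 *: v) - 0 * q v); exists 0 => //=; rewrite in_itv/= lexx.
by move=> _ [t + <-]; rewrite /= in_itv/= andbT => /h.
Qed.

(** Parameters [s] and [t] for two vectors combine to [s + t] for their sum, and [t] becomes [s * t]
    when the vector is scaled by [s]. *)
Lemma shrink_sublinear q v : sublinear q -> sublinear (shrink q v).
Proof.
move=> sq; split=> [u w|s u].
  rewrite -lerBlDl; apply: shrink_ge => t t0.
  rewrite lerBlDl -lerBlDr; apply: shrink_ge => s s0.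
  rewrite lerBlDr (le_trans (shrink_le v _ sq (addr_ge0 s0 t0)))//.
  rewrite scalerDl addrACA.
  by have := sq.1 (u + s *: v) (w + t *: v); lra.
rewrite le_eqVlt => /predU1P[<-|s0].
  rewrite scale0r mul0r (le_trans (shrink_le v _ sq (lexx _)))//.
  by rewrite scale0r mul0r addr0 subr0 sublinear0.
rewrite -ler_pdivrMl//; apply: shrink_ge => t t0; rewrite ler_pdivrMl//.
have st0 : 0 <= s * t by rewrite mulr_ge0// ltW.
rewrite (le_trans (shrink_le v _ sq st0))// -scalerA -scalerDr mulrBr mulrA.
by rewrite lerD2r; exact: sq.2 (ltW s0).
Qed.

Lemma shrink_le_id q v u : sublinear q -> shrink q v u <= q u.
Proof.
move=> sq; rewrite (le_trans (shrink_le v u sq (lexx _)))//.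
by rewrite scale0r addr0 mul0r subr0.
Qed.

Lemma shrinkN q v : sublinear q -> shrink q v (- v) <= - q v.
Proof.
move=> sq; rewrite (le_trans (shrink_le v _ sq ler01))//.
by rewrite scale1r addNr (sublinear0 sq) mul1r sub0r.
Qed.

(** The pointwise infimum works; [- p (- u)] bounds all values from below. Subadditivity uses the
    chain: of two functionals, the smaller one serves at both vectors. *)
Lemma inf_chain_sublinear p (A : set (V -> R)) : sublinear p -> A !=set0 ->
  (forall q, A q -> sublinear q /\ forall u, q u <= p u) ->
  (forall q r, A q -> A r -> (forall u, q u <= r u) \/ (forall u, r u <= q u)) ->
  exists2 q0, sublinear q0 & forall q, A q -> forall u, q0 u <= q u.
Proof.
move=> sp [qA AqA] Ap Atot; pose q0 u := inf [set q u | q in A].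
have le0 q u : A q -> q0 u <= q u.
  move=> Aq; apply: ge_inf; last by exists q.
  exists (- p (- u)) => _ [r Ar <-].
  by rewrite (le_trans _ (sublinearN _ (Ap r Ar).1))// lerN2; exact: (Ap r Ar).2.
have ge0 c u : (forall q, A q -> c <= q u) -> c <= q0 u.
  move=> h; apply: lb_le_inf; first by exists (qA u), qA.
  by move=> _ [r Ar <-]; exact: h.
clearbody q0.
exists q0; last by move=> q Aq u; exact: le0.
split=> [u v|t v].
  rewrite -lerBlDl; apply: (ge0) => q Aq.
  rewrite lerBlDl -lerBlDr; apply: (ge0) => r Ar.
  rewrite lerBlDr; have [le|le] := Atot q r Aq Ar.
    rewrite (le_trans (le0 q _ Aq))// (le_trans ((Ap q Aq).1.1 u v))//.
    by rewrite lerD2r.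
  rewrite (le_trans (le0 r _ Ar))// (le_trans ((Ap r Ar).1.1 u v))//.
  by rewrite lerD2l.
rewrite le_eqVlt => /predU1P[<-|t0].
  by rewrite scale0r mul0r -(sublinear0 (Ap qA AqA).1); exact: le0.
rewrite -ler_pdivrMl//; apply: (ge0) => q Aq; rewrite ler_pdivrMl//.
by rewrite (le_trans (le0 q _ Aq))//; exact: (Ap q Aq).1.2 (ltW t0).
Qed.

Lemma minimal_sublinear p : sublinear p -> exists q, [/\ sublinear q,
  forall u, q u <= p u &
  forall r, sublinear r -> (forall u, r u <= q u) -> r = q].
Proof.
move=> sp; pose T := {q : V -> R | sublinear q /\ forall u, q u <= p u}.
(* The order is reversed, so that a maximal element in Zorn's lemma is a minimal functional. *)
pose le (q r : T) := `[< forall u, sval r u <= sval q u >].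
have [| | |A Atot|[q [sq qp]] minq] := @Zorn T le.
- by move=> q; apply/asboolP.
- move=> q r s /asboolP qr /asboolP rs; apply/asboolP => u.
  exact: le_trans (rs u) (qr u).
- move=> [q qP] [r rP] /asboolP/= qr /asboolP/= rq; apply/eq_exist/funext => u.
  by apply/eqP; rewrite eq_le qr rq.
- have [->|/set0P[q0 Aq0]] := eqVneq A set0.
    by exists (exist _ p (conj sp (fun=> lexx _))).
  have [|q [r Ar <-]|q r [q' Aq <-] [r' Ar <-]|r sr rle] :=
      @inf_chain_sublinear p [set sval q | q in A] sp.
  - by exists (sval q0), q0.
  - exact: (svalP r).
  - by have [/asboolP|/asboolP] := Atot _ _ Aq Ar; [right|left].
  - have rp u : r u <= p u.
      by rewrite (le_trans (rle (sval q0) _ u))//; [exists q0|exact: (svalP q0).2].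
    exists (exist _ r (conj sr rp)) => s As; apply/asboolP => u.
    by apply: rle; exists s.
- exists q; split=> // r sr rq.
  have rp u : r u <= p u := le_trans (rq u) (qp u).
  by have := minq (exist _ r (conj sr rp)); move=> /(_ (introT (asboolP _) rq)) [].
Qed.

(** Minimality gives [shrink q v = q], hence oddness. Subadditivity and scaling at negated vectors
    then yield the reverse inequalities. *)
Lemma minimal_sublinear_linear q : sublinear q ->
  (forall r, sublinear r -> (forall u, r u <= q u) -> r = q) -> linear q.
Proof.
move=> sq minq.
have qN v : q (- v) = - q v.
  apply/eqP; rewrite eq_le; apply/andP; split.
    rewrite -{1}(minq (shrink q v)) ?shrinkN//; first exact: shrink_sublinear.
    by move=> u; exact: shrink_le_id.
  by rewrite lerNl sublinearN.
have qD u v : q (u + v) = q u + q v.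
  apply/eqP; rewrite eq_le sq.1/=.
  by have := sq.1 (- u) (- v); rewrite -opprD !qN; lra.
move=> a u v; rewrite qD; congr (_ + _).
have qZ b w : 0 <= b -> q (b *: w) = b * q w.
  move=> b0; apply/eqP; rewrite eq_le sq.2//=.
  by have := sq.2 b (- w) b0; rewrite scalerN !qN mulrN lerN2.
have [a0|/ltW a0] := leP 0 a; first exact: qZ.
by rewrite -[a]opprK scaleNr qN qZ ?oppr_ge0// [RHS]mulNr.
Qed.

(** Minimising below [shrink p v] instead of [p] forces [phi (- v) <= - p v], which by linearity is
    [p v <= phi v]. *)
Lemma hahn_banach p v : sublinear p ->
  exists phi : V -> R, [/\ linear phi, forall u, phi u <= p u & phi v = p v].
Proof.
move=> sp; have [q [sq qp minq]] := minimal_sublinear (shrink_sublinear v sp).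
have lq := minimal_sublinear_linear sq minq.
have qle u : q u <= p u by rewrite (le_trans (qp u))// shrink_le_id.
exists q; split=> //; apply/eqP; rewrite eq_le qle/=.
have := le_trans (qp (- v)) (shrinkN v sp).
have := lq (-1) v 0; rewrite addr0 scaleN1r (sublinear0 sq) addr0 => ->.
by rewrite scaleN1r lerN2.
Qed.

End HahnBanach.

(** * Countably valued maps and measurable glueing *)

Section CountablyValued.
Context (d : measure_display) (X : measurableType d).

Definition measurable_fibers (T : Type) (w : X -> T) :=
  forall t, measurable (w @^-1` [set t]).

(** The index [k] encodes a measurable partition and [v] the values on its blocks, so [T] needs no
    sigma-algebra. *)
Definition countably_valued (T : Type) (w : X -> T) :=
  exists k : X -> nat, exists v : nat -> T,
    measurable_fibers k /\ forall x, w x = v (k x).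

Lemma countably_valued_countType (T : countType) (w : X -> T) :
  measurable_fibers w -> countably_valued w.
Proof.
move=> mw; exists (pickle \o w), (odflt (w point) \o unpickle).
split=> [n|x]; last by rewrite /= pickleK.
(* [pickle_inv] tells whether [n] is the code of some [t]: the fibre over [n] is that of [w] over
   [t], or empty. *)
case E : (@pickle_inv T n) => [t|].
- rewrite (_ : _ @^-1` _ = w @^-1` [set t])//; apply/seteqP; split=> x /= h.
    by move: E; rewrite -h pickleK_inv => -[].
  by rewrite h; have := @pickle_invK T n; rewrite E.
- rewrite (_ : _ @^-1` _ = set0)//; apply/seteqP; split=> x //= h.
  by move: E; rewrite -h pickleK_inv.
Qed.

Lemma countably_valued_comp (T U : Type) (g : T -> U) (w : X -> T) :
  countably_valued w -> countably_valued (g \o w).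
Proof.
by move=> [k [v [mk wE]]]; exists k, (g \o v); split=> // x; rewrite /= wE.
Qed.

(** The pair of the block and the index inside that block takes countably many values, and its
    fibres are intersections of measurable fibres. *)
Lemma countably_valued_glue (T : Type) (k : X -> nat) (w : nat -> X -> T) :
  measurable_fibers k -> (forall n, countably_valued (w n)) ->
  countably_valued (fun x => w (k x) x).
Proof.
move=> mk /choice[kk] /choice[v kv].
have : countably_valued (fun x => (k x, kk (k x) x)).
  apply: countably_valued_countType => -[i j].
  rewrite (_ : _ @^-1` _ = k @^-1` [set i] `&` kk i @^-1` [set j]).
    by apply: measurableI; [exact: mk|exact: (kv i).1].
  by apply/seteqP; split=> x /= [<- <-].
move=> /(countably_valued_comp (fun ij => v ij.1 ij.2)).
by congr countably_valued; apply/funext => x; rewrite (kv (k x)).2.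
Qed.

Lemma countably_valued_cst (T : Type) (t : T) : countably_valued (fun=> t).
Proof.
exists (fun=> 0%N), (fun=> t); split=> // n.
by rewrite preimage_cst; case: ifP.
Qed.

Lemma countably_valued_comp2 (T U W : Type) (g : T -> U -> W) w1 w2 :
  countably_valued w1 -> countably_valued w2 ->
  countably_valued (fun x => g (w1 x) (w2 x)).
Proof.
move=> [k [v [mk w1E]]] cw2.
have := countably_valued_glue mk
  (fun n => countably_valued_comp (g (v n)) cw2).
by congr countably_valued; apply/funext => x; rewrite /= w1E.
Qed.

Lemma mpartition_index (A : mpartition X) :
  exists k : X -> nat, forall n, A n = k @^-1` [set n].
Proof.
have /choice[k kA] x : exists n, A n x.
  have : (\bigcup_n A n) x by rewrite block_bigcup.
  by move=> [n _ ?]; exists n.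
exists k => n; apply/seteqP; split=> [x Anx|x <-//].
by apply: (block_trivIset (m := A)) => //; exists x.
Qed.

Definition fibers (k : X -> nat) (mk : measurable_fibers k) : mpartition X.
Proof.
exists (fun n => k @^-1` [set n]) => //.
- by move=> i j _ _ [x [<- <-]].
- by apply/seteqP; split=> // x _; exists (k x).
Defined.

Context (R : realType).

Lemma measurable_fun_glue (k : X -> nat) (h : nat -> X -> R) :
  measurable_fibers k -> (forall n, measurable_fun [set: X] (h n)) ->
  measurable_fun [set: X] (fun x => h (k x) x).
Proof.
move=> mk mh _ Y mY; rewrite setTI.
rewrite (_ : _ @^-1` _ = \bigcup_n (k @^-1` [set n] `&` h n @^-1` Y)).
  apply: bigcup_measurable => n _; apply: measurableI; first exact: mk.
  by rewrite -[X in measurable X]setTI; exact: mh.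
by apply/seteqP; split=> [x hx|x [n _ [/= <-]]]//; exists (k x).
Qed.

Lemma countably_valued_floor (f : X -> R) : measurable_fun [set: X] f ->
  countably_valued (fun x => Num.floor (f x)).
Proof.
move=> mf; apply: countably_valued_countType => z.
rewrite (_ : _ @^-1` _ = [set: X] `&` f @^-1` `[z%:~R, (z + 1)%:~R[).
  exact: mf.
rewrite setTI; apply/seteqP; split=> x /=; rewrite in_itv/=.
  by move=> <-; exact: floor_itv.
by move=> h; apply: floor_def.
Qed.

(** Rounding [f] down to integer multiples of [e] gives [h]. *)
Lemma bmfun_approx (f : bmfun X R) (e : R) : 0 < e ->
  exists2 h : X -> R, countably_valued h & forall x, `|f x - h x| <= e.
Proof.
move=> e0; exists (fun x => (Num.floor (f x / e))%:~R * e).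
  apply: (@countably_valued_comp _ _ (fun z => z%:~R * e)).
  apply: countably_valued_floor.
  by apply: measurable_funM; [exact: bmfun_measurable|exact: measurable_cst].
move=> x; rewrite -{1}[f x](divfK (lt0r_neq0 e0)) -mulrBl normrM.
rewrite (gtr0_norm e0) ler_piMl ?(ltW e0)//.
rewrite ger0_norm ?subr_ge0 ?ge_floor// lerBlDl.
by have /andP[_ /ltW] := floor_itv (f x / e); rewrite intrD addrC.
Qed.

(** This turns the extended real hypothesis of the glueing axiom into a uniform real bound on the
    blocks. *)
Lemma ereal_sup_blocksP (A : mpartition X) (f : nat -> bmfun X R) :
  (ereal_sup (range (fun n => sup_on (A n) (f n))) < +oo)%E <->
  exists C : R, forall n x, A n x -> f n x <= C.
Proof.
have ub n x : A n x ->
    ((f n x)%:E <= ereal_sup (range (fun n => sup_on (A n) (f n))))%E.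
  move=> Anx; apply: (@le_trans _ _ (sup_on (A n) (f n))).
    by apply: ereal_sup_ubound; exists x.
  by apply: ereal_sup_ubound; exists n.
split=> [|[C fC]]; last first.
  apply: (@le_lt_trans _ _ C%:E); last exact: ltry.
  apply: ge_ereal_sup => _ [n _ <-]; apply: ge_ereal_sup => _ [x Ax <-].
  by rewrite lee_fin fC.
case E : (ereal_sup _) ub => [C| |] // ub _.
- by exists C => n x /ub; rewrite lee_fin.
- by exists 0 => n x /ub.
Qed.

End CountablyValued.

(** This controls the error of a product when both factors are approximated: [a] and [b] are values
    of a function and its approximant, [n] is the norm of a module element and [r] the error made on
    it. *)
Lemma mul_approx (R : realFieldType) (B C e : R) : 0 <= B -> 0 <= C -> 0 < e ->
  exists2 h, 0 < h & forall a b n r : R, `|a| <= B -> `|a - b| <= h ->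
    0 <= n <= C -> 0 <= r <= h -> `|a - b| * n + `|b| * r <= e.
Proof.
move=> B0 C0 e0; have S0 : 0 < C + (B + 1) by rewrite !ltr_wpDl// ltr01.
(* The minimum with [1] ensures [|b| <= B + 1], so the total error is at most
   [h * (C + (B + 1))]. *)
exists (Num.min 1 (e / (C + (B + 1)))) => [|a b n r aB].
  by rewrite lt_min ltr01 divr_gt0.
rewrite !le_min => /andP[ab1 abh] /andP[n0 nC] /and3P[r0 _ rh].
have bB : `|b| <= B + 1.
  have -> : b = a - (a - b) by ring.
  by rewrite (le_trans (ler_normB _ _))// lerD.
apply: (@le_trans _ _ (e / (C + (B + 1)) * (C + (B + 1)))).
  by rewrite mulrDr; apply: lerD; [exact: ler_pM|rewrite mulrC ler_pM].
by rewrite divfK// gt_eqF.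
Qed.

(** * Seminorms depending measurably on a point, and sections of the completed fibres *)

Record seminorm_family (d : measure_display) (X : measurableType d)
    (R : realType) (V : lmodType R) := SeminormFamily {
  seminorm_at :> V -> bmfun X R;
  seminorm_atD : forall u v x,
    seminorm_at (u + v) x <= seminorm_at u x + seminorm_at v x;
  seminorm_atZ : forall a v x,
    seminorm_at (a *: v) x = `|a| * seminorm_at v x }.

Section Germs.
Context (d : measure_display) (X : measurableType d) (R : realType).
Context (V : lmodType R) (p : seminorm_family X V).
Implicit Types (x : X) (u v : V) (phi : V -> R) (w : X -> V).
Implicit Types (s t : X -> (V -> R) -> R).

Lemma seminorm_at0 x : p 0 x = 0.
Proof. by rewrite -(scale0r 0) seminorm_atZ normr0 mul0r. Qed.

Lemma seminorm_atN v x : p (- v) x = p v x.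
Proof. by rewrite -scaleN1r seminorm_atZ normrN1 mul1r. Qed.

Lemma seminorm_at_ge0 v x : 0 <= p v x.
Proof.
by have := seminorm_atD p v (- v) x; rewrite subrr seminorm_at0 seminorm_atN; lra.
Qed.

Lemma seminorm_at_measurable w : countably_valued w ->
  measurable_fun [set: X] (fun x => p (w x) x).
Proof.
move=> [k [v [mk wE]]].
under eq_fun do rewrite wE.
apply: (measurable_fun_glue (h := fun n => p (v n)) mk) => n.
exact: bmfun_measurable.
Qed.

Definition dual_ball x : set (V -> R) :=
  [set phi | linear phi /\ forall v, `|phi v| <= p v x].

(* A section is thus zero off the dual balls: there [germ] vanishes, and the
   section is within every [e > 0] of a germ. *)
Definition germ x v phi : R := if phi \in dual_ball x then phi v else 0.

Lemma germD x u v phi : germ x (u + v) phi = germ x u phi + germ x v phi.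
Proof.
rewrite /germ; case: ifPn; last by rewrite addr0.
by rewrite inE => -[/(_ 1 u v)]; rewrite !scale1r.
Qed.

Lemma germZ x a v phi : germ x (a *: v) phi = a * germ x v phi.
Proof.
rewrite /germ; case: ifPn; last by rewrite mulr0.
rewrite inE => -[lphi _].
have phi0 : phi 0 = 0.
  by have := lphi (-1) 0 0; rewrite scaler0 addr0 scaleN1r addNr.
by have := lphi a v 0; rewrite !addr0 phi0 addr0.
Qed.

Lemma germ0 x phi : germ x 0 phi = 0.
Proof. by rewrite -(scale0r 0) germZ mul0r. Qed.

Lemma germN x v phi : germ x (- v) phi = - germ x v phi.
Proof. by rewrite -scaleN1r germZ mulN1r. Qed.

Lemma norm_germ_le x v phi : `|germ x v phi| <= p v x.
Proof.
rewrite /germ; case: ifPn => [|_]; last by rewrite normr0 seminorm_at_ge0.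
by rewrite inE => -[].
Qed.

(** The norming functional from Hahn-Banach lies in the dual ball, since domination at [u] and at
    [- u] bounds [|phi u|]. *)
Lemma norm_germ_attained x v : exists phi, germ x v phi = p v x.
Proof.
have [|phi [lphi phip phiv]] := @hahn_banach _ _ (fun v => p v x) v.
  split=> [u w|a w a0]; first exact: seminorm_atD.
  by rewrite seminorm_atZ ger0_norm.
exists phi; rewrite /germ mem_set//; split=> // u.
have phiN : phi (- u) = - phi u.
  have := lphi (-1) u u; rewrite scaleN1r addNr => phi0.
  have := lphi (-1) u 0; rewrite scaleN1r addr0 phi0.
  by rewrite !scaleN1r addrC addrK.
rewrite ler_norml phip andbT lerNl -phiN (le_trans (phip _))//.
by rewrite seminorm_atN.
Qed.

Definition section_pred : {pred X -> (V -> R) -> R} := mem [set s |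
  (exists C, forall x phi, `|s x phi| <= C) /\
  forall e, 0 < e -> exists2 w, countably_valued w &
    forall x phi, `|s x phi - germ x (w x) phi| <= e].

Lemma germ_section w (C : R) : countably_valued w -> (forall x, p (w x) x <= C) ->
  (fun x => germ x (w x)) \in section_pred.
Proof.
move=> cw wC; rewrite inE; split.
  by exists C => x phi; rewrite (le_trans (norm_germ_le _ _ _)).
by move=> e e0; exists w => // x phi; rewrite subrr normr0 ltW.
Qed.

Lemma section_zmod_closed : zmod_closed section_pred.
Proof.
split.
  rewrite inE; split; first by exists 0 => x phi; rewrite normr0.
  move=> e e0; exists (fun=> 0); first exact: countably_valued_cst.
  by move=> x phi; rewrite germ0 subr0 normr0 ltW.
move=> s t; rewrite !inE => -[[C sC] sa] [[D tD] ta]; split.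
  exists (C + D) => x phi.
  by rewrite (le_trans (ler_normB _ _))// lerD.
move=> e e0; have e20 : 0 < e / 2 by rewrite divr_gt0.
have [w cw sw] := sa _ e20; have [w' cw' tw] := ta _ e20.
exists (fun x => w x - w' x).
  exact: (countably_valued_comp2 (fun u v => u - v)).
move=> x phi; rewrite germD germN.
rewrite (_ : (s - t) x phi = s x phi - t x phi)// opprD addrACA -opprD.
by rewrite (le_trans (ler_normB _ _))// [leRHS]splitr lerD.
Qed.

(** The products [f x *: w x] may take uncountably many values, so [f] is first replaced by a
    countably valued [g]. *)
Lemma section_scale_closed (f : bmfun X R) s : s \in section_pred ->
  (fun x phi => f x * s x phi) \in section_pred.
Proof.
rewrite !inE => -[[C sC] sa]; have [B fB] := bmfun_bounded f.
have C0 : 0 <= C by rewrite (le_trans _ (sC point (fun=> 0))).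
have B0 : 0 <= B by rewrite (le_trans _ (fB point)).
split; first by exists (B * C) => x phi; rewrite normrM ler_pM.
move=> e e0; have [h h0 hP] := mul_approx B0 C0 e0.
have [g cg fg] := bmfun_approx f h0; have [w cw sw] := sa h h0.
exists (fun x => g x *: w x); first exact: (countably_valued_comp2 _ cg cw).
move=> x phi; rewrite germZ.
have -> : f x * s x phi - g x * germ x (w x) phi =
    (f x - g x) * s x phi + g x * (s x phi - germ x (w x) phi) by ring.
rewrite (le_trans (ler_normD _ _))// !normrM.
by apply: hP; rewrite // normr_ge0 /=.
Qed.

Definition section_norm s x : R := sup (range (fun phi => `|s x phi|)).

Lemma section_norm_le s x (C : R) : (forall phi, `|s x phi| <= C) ->
  section_norm s x <= C.
Proof.
by move=> sC; apply: ge_sup => [|_ [phi _ <-]//]; exists `|s x (fun=> 0)|, (fun=> 0).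
Qed.

Lemma section_norm_ub s x phi : s \in section_pred ->
  `|s x phi| <= section_norm s x.
Proof.
rewrite inE => -[[C sC] _]; apply: sup_upper_bound; last by exists phi.
by split; [exists `|s x phi|, phi|exists C => _ [psi _ <-]].
Qed.

(** The embedding of each fibre is isometric: membership in the dual ball gives one inequality, a
    norming functional the other. *)
Lemma section_norm_germ w x : section_norm (fun x => germ x (w x)) x = p (w x) x.
Proof.
apply/eqP; rewrite eq_le section_norm_le/= => [|phi]; last exact: norm_germ_le.
have [phi phiw] := norm_germ_attained x (w x).
apply: sup_upper_bound; last first.
  by exists phi; rewrite // phiw ger0_norm// seminorm_at_ge0.
split; first by exists `|germ x (w x) phi|, phi.
by exists (p (w x) x) => _ [psi _ <-]; exact: norm_germ_le.
Qed.

Lemma section_norm_approx s x v (e : R) : s \in section_pred ->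
  (forall phi, `|s x phi - germ x v phi| <= e) -> `|section_norm s x - p v x| <= e.
Proof.
move=> sS sv; rewrite ler_distl; apply/andP; split.
  have [phi phiv] := norm_germ_attained x v.
  rewrite lerBlDr -phiv (le_trans (ler_norm _))//.
  have -> : germ x v phi = s x phi - (s x phi - germ x v phi) by ring.
  by rewrite (le_trans (ler_normB _ _))// lerD// section_norm_ub.
apply: section_norm_le => phi.
have -> : s x phi = germ x v phi + (s x phi - germ x v phi) by ring.
by rewrite (le_trans (ler_normD _ _))// lerD// norm_germ_le.
Qed.

(** A supremum over uncountably many functionals need not be measurable. Measurability comes from
    the pointwise limit of [p (w n x) x], where [w n] approximates [s] up to [1 / (n + 1)]. *)
Lemma section_norm_bmfun s : s \in section_pred -> section_norm s \in @bmfun_pred _ X R.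
Proof.
move=> sS; apply/bmfun_predE; split; last first.
  move: (sS); rewrite inE => -[[C sC] _]; exists C => x.
  rewrite ger0_norm ?section_norm_le//.
  exact: le_trans (section_norm_ub x (fun=> 0) sS).
have /choice[w wP] (n : nat) : exists w, countably_valued w /\
    forall x phi, `|s x phi - germ x (w x) phi| <= n.+1%:R^-1.
  move: (sS); rewrite inE => -[_ /(_ n.+1%:R^-1)].
  by rewrite invr_gt0 ltr0n => -[]// w; exists w.
apply: (measurable_fun_cvg (h := fun n x => p (w n x) x)).
  by move=> n; apply: seminorm_at_measurable; have [] := wP n.
move=> x _; apply/cvgrPdist_le => e e0.
have [N _ NP] := near_infty_natSinv_lt (PosNum e0).
exists N => // n /= /NP/= /ltW en; rewrite (le_trans _ en)//.
by apply: section_norm_approx => // phi; have [_] := wP n.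
Qed.

End Germs.

(** * Pointwise distances, Cauchy sequences and limits in a normed module *)

Section PointwiseNorm.
Context (d : measure_display) (X : measurableType d) (R : realType).
Context (N : bmfunPNormedType X R).
Implicit Types (s t : N) (e : R).

Lemma bm_pnorm0 x : bm_pnorm (0 : N) x = 0.
Proof. by move: x; exact/bm_pnorm_eq0. Qed.

Lemma bm_pnormN s x : bm_pnorm (- s) x = bm_pnorm s x.
Proof. by rewrite -scaleN1r bm_pnormZ bmfunNE bmfun1E normrN1 mul1r. Qed.

Lemma bm_pnorm_distC s t x : bm_pnorm (s - t) x = bm_pnorm (t - s) x.
Proof. by rewrite -opprB bm_pnormN. Qed.

Lemma bm_pnorm_triangle t s r x :
  bm_pnorm (s - r) x <= bm_pnorm (s - t) x + bm_pnorm (t - r) x.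
Proof. by rewrite (le_trans _ (bm_pnormD _ _ _))// addrA subrK. Qed.

Lemma bm_pnorm_dist_le s t x :
  `|bm_pnorm s x - bm_pnorm t x| <= bm_pnorm (s - t) x.
Proof.
have := bm_pnormD (s - t) t x; have := bm_pnormD (t - s) s x.
by rewrite !subrK (bm_pnorm_distC t) ler_norml => ? ?; apply/andP; split; lra.
Qed.

(** Multiplying [s - t] by the indicator multiplies its pointwise norm by the indicator. The
    identities of the glueing axiom can thus be checked point by point. *)
Lemma bm_scale_indicP (A : set X) (mA : measurable A) s t :
  bmfun_indic R mA *: s = bmfun_indic R mA *: t <->
  forall x, A x -> bm_pnorm (s - t) x = 0.
Proof.
split=> [st x Ax|st].
  have /bm_pnorm_eq0/(_ x) : bmfun_indic R mA *: (s - t) = 0.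
    by rewrite scalerBr st subrr.
  by rewrite bm_pnormZ /= indicE mem_set// normr1 mul1r.
apply/eqP; rewrite -subr_eq0 -scalerBr; apply/eqP/bm_pnorm_eq0 => x.
rewrite bm_pnormZ /= indicE; have [/[!inE]/st->|_] := boolP (x \in A).
  by rewrite mulr0.
by rewrite normr0 mul0r.
Qed.

Lemma bm_norm_leP (s : bm_normed N) e :
  `|s| <= e <-> forall x, bm_pnorm (s : N) x <= e.
Proof.
have sE x : `|bm_pnorm (s : N) x| = bm_pnorm (s : N) x.
  by rewrite ger0_norm ?bm_pnorm_ge0.
split=> se => [x|]; last by apply: sup_norm_le => x; rewrite sE.
by rewrite -sE; apply: le_trans se; exact: sup_norm_ub.
Qed.

Lemma bm_cauchyP (u : nat -> bm_normed N) :
  cauchy (u @ \oo) <-> forall e, 0 < e -> exists K, forall m n,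
    (K <= m)%N -> (K <= n)%N -> forall x, bm_pnorm (u m - u n : N) x <= e.
Proof.
split=> [/cauchy_ballP cu e e0|cu].
  have [[A B] /= [[K _ KA] [L _ LB]] AB] := cu e e0.
  exists (maxn K L) => m n; rewrite !geq_max => /andP[Km _] /andP[_ Ln].
  apply/bm_norm_leP.
  have := AB (u m, u n) (conj (KA m Km) (LB n Ln)).
  by rewrite /= -ball_normE => /ltW.
(* Half of [e] is used because balls are open while the estimate is not strict. *)
apply/cauchy_exP => e e0; have [K Ku] := cu (e / 2) (divr_gt0 e0 (ltr0Sn _ _)).
exists (u K); exists K => // n /= Kn.
rewrite -ball_normE/= (@le_lt_trans _ _ (e / 2)) ?ltr_pdivrMr ?ltr_pMr ?ltr1n//.
by apply/bm_norm_leP; exact: Ku.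
Qed.

Lemma bm_cvgP (u : nat -> bm_normed N) (l : bm_normed N) :
  u @ \oo --> l <-> forall e, 0 < e -> exists K, forall n,
    (K <= n)%N -> forall x, bm_pnorm (l - u n : N) x <= e.
Proof.
split=> [/cvgrPdist_le ul e /ul[K _ KP]|ul].
  by exists K => n Kn; apply/bm_norm_leP; exact: KP.
apply/cvgrPdist_le => e /ul[K KP]; exists K => // n Kn.
by apply/bm_norm_leP; exact: KP.
Qed.

End PointwiseNorm.

(** * The normed module of measurable sections *)

Section MeasurableSections.
Context (d : measure_display) (X : measurableType d) (R : realType).
Context (V : lmodType R) (p : seminorm_family X V).

Record msection := MSection {
  msection_fun :> X -> (V -> R) -> R;
  msectionP : msection_fun \in section_pred p }.

HB.instance Definition _ := [isSub for msection_fun].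
HB.instance Definition _ := [Choice of msection by <:].
HB.instance Definition _ :=
  GRing.isZmodClosed.Build _ (section_pred p) (section_zmod_closed p).
HB.instance Definition _ := [SubChoice_isSubZmodule of msection by <:].

Implicit Types (s t : msection) (f g : bmfun X R).

Lemma msection_eqP s t : s = t <-> forall x phi, s x phi = t x phi.
Proof.
by split=> [->//|st]; apply/val_inj/funext => x; apply/funext => phi.
Qed.

Lemma msectionDE s t x phi : (s + t) x phi = s x phi + t x phi.
Proof. by []. Qed.

Lemma msection_bounded s : exists C, forall x phi, `|s x phi| <= C.
Proof. by have := msectionP s; rewrite inE => -[]. Qed.

Lemma msection_approx s e : 0 < e -> exists2 w, countably_valued w &
  forall x phi, `|s x phi - germ p x (w x) phi| <= e.
Proof. by have := msectionP s; rewrite inE => -[_]; exact. Qed.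

Definition msection_scale f s : msection :=
  MSection (section_scale_closed f (msectionP s)).

Let scaleA f g s : msection_scale f (msection_scale g s) = msection_scale (f * g) s.
Proof. by apply/msection_eqP => x phi; exact: mulrA. Qed.
Let scale1 : left_id 1 msection_scale.
Proof. by move=> s; apply/msection_eqP => x phi; exact: mul1r. Qed.
Let scaleDr : right_distributive msection_scale +%R.
Proof.
by move=> f s t; apply/msection_eqP => x phi; exact: mulrDr.
Qed.
Let scaleDl s : {morph msection_scale^~ s : f g / f + g}.
Proof.
by move=> f g; apply/msection_eqP => x phi; exact: mulrDl.
Qed.

HB.instance Definition _ := GRing.Zmodule_isLmodule.Build (bmfun X R) msection
  scaleA scale1 scaleDr scaleDl.

Lemma msectionZE f s x phi : (f *: s) x phi = f x * s x phi. Proof. by []. Qed.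

Definition msection_norm s : bmfun X R := BMFun (section_norm_bmfun (msectionP s)).

Lemma msection_norm_ub s x phi : `|s x phi| <= msection_norm s x.
Proof. exact: section_norm_ub (msectionP s). Qed.

Lemma msection_norm_le s x (C : R) : (forall phi, `|s x phi| <= C) ->
  msection_norm s x <= C.
Proof. exact: section_norm_le. Qed.

Let norm_ge0 s x : 0 <= msection_norm s x.
Proof. exact: le_trans (msection_norm_ub s x (fun=> 0)). Qed.

Let norm_eq0 s : (forall x, msection_norm s x = 0) <-> s = 0.
Proof.
split=> [s0|-> x]; last first.
  apply/eqP; rewrite eq_le norm_ge0 andbT.
  by apply: msection_norm_le => phi; rewrite normr0.
apply/msection_eqP => x phi; apply/eqP; rewrite -normr_le0.
by rewrite (le_trans (msection_norm_ub _ _ _))// s0.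
Qed.

Let normD s t x : msection_norm (s + t) x <= msection_norm s x + msection_norm t x.
Proof.
apply: msection_norm_le => phi; rewrite msectionDE (le_trans (ler_normD _ _))//.
by rewrite lerD ?msection_norm_ub.
Qed.

Let normZ f s x : msection_norm (f *: s) x = `|f x| * msection_norm s x.
Proof.
apply/eqP; rewrite eq_le; apply/andP; split.
  apply: msection_norm_le => phi.
  by rewrite msectionZE normrM ler_wpM2l// msection_norm_ub.
have [->|f0] := eqVneq (f x) 0; first by rewrite normr0 mul0r norm_ge0.
rewrite -ler_pdivlMl ?normr_gt0//; apply: msection_norm_le => phi.
by rewrite ler_pdivlMl ?normr_gt0// -normrM -msectionZE msection_norm_ub.
Qed.

HB.instance Definition _ := isBmfunPointwiseNormed.Build d X R msection
  norm_ge0 norm_eq0 normD normZ.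

Lemma msection_dist_leP s t x e :
  bm_pnorm (s - t) x <= e <-> forall phi, `|s x phi - t x phi| <= e.
Proof.
split=> [ste phi|]; last exact: (@msection_norm_le (s - t)).
exact: le_trans (msection_norm_ub (s - t) x phi) ste.
Qed.

(** The value at [x] comes from the section of the block containing [x], and approximants are glued
    along the same index. Uniqueness holds because the blocks cover [X]. *)
Let glueing (A : mpartition X) (v : nat -> msection) :
  (ereal_sup (range (fun n => sup_on (A n) (bm_pnorm (v n)))) < +oo)%E ->
  exists! s : msection, forall n,
    bmfun_indic R (block_measurable A n) *: s =
    bmfun_indic R (block_measurable A n) *: v n.
Proof.
move=> /ereal_sup_blocksP[C vC]; have [k kA] := mpartition_index A.
have mk : measurable_fibers k.
  by move=> n; rewrite -kA; exact: block_measurable.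
have sP : (fun x => v (k x) x) \in section_pred p.
  rewrite inE; split.
    exists C => x phi; rewrite (le_trans (msection_norm_ub _ _ _))//.
    by apply: vC; rewrite kA.
  move=> e e0; have /choice[w wP] n : exists w, countably_valued w /\
      forall x phi, `|v n x phi - germ p x (w x) phi| <= e.
    by have [w] := msection_approx (v n) e0; exists w.
  exists (fun x => w (k x) x); last by move=> x phi; exact: (wP (k x)).2.
  by apply: countably_valued_glue => // n; exact: (wP n).1.
exists (MSection sP); split=> [n|t tv].
  apply/bm_scale_indicP => x; rewrite kA => <-.
  apply/eqP; rewrite eq_le bm_pnorm_ge0 andbT.
  by apply/msection_dist_leP => phi /=; rewrite subrr normr0.
apply/msection_eqP => x phi /=; apply/eqP.
rewrite eq_sym -subr_eq0 -normr_le0; move: phi; apply/msection_dist_leP.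
have /bm_scale_indicP -> := tv (k x); first exact: lexx.
by rewrite kA.
Qed.

(** The sequence is Cauchy uniformly in the point and the functional, so pointwise limits exist in
    [R], and approximants of a late term also approximate the limit. *)
Let complete (u : nat -> bm_normed msection) : cauchy (u @ \oo) -> cvgn u.
Proof.
move=> /bm_cauchyP cu.
have /choice[K KP] (e : {posnum R}) : exists K, forall m n, (K <= m)%N ->
    (K <= n)%N -> forall x phi, `|(u m : msection) x phi - (u n : msection) x phi| <= e%:num.
  have [K KP] := cu e%:num (gt0 e); exists K => m n Km Kn x.
  exact/msection_dist_leP/KP.
pose l x phi : R := limn (fun n => (u n : msection) x phi).
have cvl x phi : (fun n => (u n : msection) x phi) @ \oo --> l x phi.
  suff /cauchy_cvg : cauchy ((fun n => (u n : msection) x phi) @ \oo) by [].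
  apply/cauchy_exP => e e0; pose e' := PosNum (divr_gt0 e0 (ltr0Sn R 1)).
  exists ((u (K e') : msection) x phi); exists (K e') => // n /= Kn.
  rewrite -ball_normE/= (@le_lt_trans _ _ (e / 2)) ?ltr_pdivrMr ?ltr_pMr ?ltr1n//.
  exact: (KP e').
have lu e n x phi : (K e <= n)%N -> `|l x phi - (u n : msection) x phi| <= e%:num.
  move=> Kn; apply/ler_addgt0Pr => h h0.
  have /cvgrPdist_le/(_ h h0)[L _ LP] := cvl x phi.
  (* The index [m] depends on [x] and [phi], but the resulting bound does not. *)
  pose m := maxn L (K e); rewrite [leRHS]addrC.
  rewrite (le_trans (ler_distD ((u m : msection) x phi) _ _))// lerD//.
    by apply: LP; rewrite /= leq_maxl.
  by apply: KP; rewrite ?leq_maxr.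
have lP : l \in section_pred p.
  rewrite inE; split.
    have [C uC] := msection_bounded (u (K 1%:pos)).
    exists (1 + C) => x phi.
    rewrite -[l x phi](subrK ((u (K 1%:pos) : msection) x phi)).
    rewrite (le_trans (ler_normD _ _))// lerD//.
    exact: (lu 1%:pos _ x phi (leqnn _)).
  move=> e e0; pose e' := PosNum (divr_gt0 e0 (ltr0Sn R 1)).
  have [w cw uw] := msection_approx (u (K e')) (gt0 e').
  exists w => // x phi.
  rewrite (le_trans (ler_distD ((u (K e') : msection) x phi) _ _))//.
  by rewrite [leRHS]splitr lerD//; exact: (lu e').
apply/cvg_ex; exists (MSection lP : bm_normed msection); apply/bm_cvgP => e e0.
exists (K (PosNum e0)) => n Kn x; apply/msection_dist_leP => phi /=.
exact: (lu (PosNum e0)).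
Qed.

HB.instance Definition _ := isNormedBmfunModule.Build d X R msection
  glueing complete.

End MeasurableSections.

(** * Positivity of the operator associated with a lifting *)

Section AssociatedOperator.
Context (d : measure_display) (X : measurableType d) (R : realType).
Context (m : {measure set X -> \bar R}) (ell : lifting m).
Context (L : {linear Linf m -> bmfun X R}) (ellL : associated_operator ell L).
Implicit Types (f : bmfun X R) (F G : Linf m).

Lemma Linf_norm_class_le f (c : R) : (forall x, `|f x| <= c) ->
  `|Linf_class m f| <= c.
Proof.
move=> fc; apply: Linf_norm_le.
  exact: le_trans (fc point).
by apply: filterS (Linf_reprP m f) => x ->.
Qed.

(** Continuity only gives some constant [K]; positivity needs nothing sharper, as the remainder
    there is halved repeatedly. *)
Lemma associated_operator_bounded : exists2 K : R, 0 < K &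
  forall f (c : R), (forall x, `|f x| <= c) ->
  forall x, `|L (Linf_class m f) x| <= K * c.
Proof.
have [K K0 LK] : exists2 K : R, 0 < K & forall F, `|L F| <= K * `|F|.
  have /linear_boundedP/pinfty_ex_gt0[K K0 LK] :=
    continuous_linear_bounded 0 (ellL.1 0).
  by exists K.
exists K => // f c fc x; rewrite (le_trans (sup_norm_ub _ _))//.
rewrite (le_trans (LK _))// ler_wpM2l ?(ltW K0)//.
exact: Linf_norm_class_le.
Qed.

(* Cutting [f] at half its height peels off a multiple of an indicator, on
   which [L] is nonnegative, and halves the bound on the remainder. *)
Lemma associated_operator_ge0_class f : (forall x, 0 <= f x) ->
  forall x, 0 <= L (Linf_class m f) x.
Proof.
move=> f0 x; have [K K0 LK] := associated_operator_bounded.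
have halving n : forall (c : R) (g : bmfun X R), (forall y, 0 <= g y <= c) ->
    - (K * (c / 2 ^+ n)) <= L (Linf_class m g) x.
  elim: n => [|n IH] c g gc.
    rewrite expr0 divr1 lerNl (le_trans (ler_norm _))// normrN LK// => y.
    by have /andP[g0 gc'] := gc y; rewrite ger0_norm.
  pose A := g @^-1` `[c / 2, +oo[.
  have mA : measurable A.
    by rewrite -[A]setTI; apply: bmfun_measurable => //; exact: measurable_itv.
  pose h := (c / 2) *: bmfun_indic R mA.
  have c0 : 0 <= c by have /andP[g0 gc'] := gc point; exact: le_trans gc'.
  have -> : g = h + (g - h) by rewrite addrC subrK.
  rewrite Linf_classD linearD bmfunDE /h Linf_classZ [L (_ *: _)]linearZZ bmfunZE.
  rewrite (ellL.2 _ mA) -/h -[leLHS]add0r lerD//.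
    by rewrite mulr_ge0 ?divr_ge0// /= indicE.
  have -> : c / 2 ^+ n.+1 = c / 2 / 2 ^+ n by rewrite exprS invfM mulrA.
  apply: IH => y.
  rewrite bmfunDE bmfunNE bmfunZE /= indicE.
  have /andP[g0 gc'] := gc y.
  have [yA|yA] := boolP (y \in A).
    by move: yA; rewrite inE /A/= in_itv/= andbT mulr1 => yA; lra.
  move: yA; rewrite notin_setE /A/= in_itv/= andbT mulr0 subr0 g0.
  by move=> /negP; rewrite -ltNge => /ltW.
have [c fc] := bmfun_bounded f.
have c0 : 0 <= c by exact: le_trans (fc point).
rewrite -oppr_le0; apply/ler_addgt0Pr => e e0; rewrite add0r lerNl.
have cvg0 : (fun n => K * c * (2^-1) ^+ n) @ \oo --> (K * c * 0 : R).
  apply: cvgMr => //; apply: cvg_expr.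
  by rewrite ger0_norm ?invr_ge0// invf_lt1// ltr1n.
have /cvgrPdist_le/(_ e e0)[n _ /(_ n (leqnn n))] := cvg0.
rewrite mulr0 sub0r normrN => h.
apply: le_trans (halving n c f _); last by move=> y; rewrite f0 (le_trans (ler_norm _)).
by rewrite lerN2 (le_trans _ h)// (le_trans _ (ler_norm _))// exprVn mulrA.
Qed.

Lemma associated_operator_mono F G : Linf_le F G -> forall x, L F x <= L G x.
Proof.
move=> FG x; rewrite -subr_ge0 -bmfunNE -bmfunDE -linearB.
pose f := repr (G - F).
have f_ge0 : {ae m, forall x, 0 <= f x}.
  have := Linf_reprD (G - F) F; rewrite subrK => GE.
  by apply: filterS2 FG GE => y h; rewrite -/f => e; rewrite e lerDr in h.
(* The positive part of [f] has the same class and is nonnegative everywhere, not just almost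
   everywhere. *)
have -> : G - F = Linf_class m (2^-1 *: (f + bmfun_abs f)).
  rewrite -[LHS]Linf_reprK; apply/Linf_classP; apply: filterS f_ge0 => y fy.
  by rewrite bmfunZE bmfunDE /= ger0_norm// -/f; lra.
apply: associated_operator_ge0_class => y.
by rewrite bmfunZE mulr_ge0// bmfunDE /= addrC -lerBlDr sub0r -normrN ler_norm.
Qed.

Context (M : LinfPNormedType m).

Lemma lift_pnormD (u v : Linf_normed M) x :
  L (Linf_pnorm (u + v : M)) x <= L (Linf_pnorm (u : M)) x + L (Linf_pnorm (v : M)) x.
Proof.
by rewrite -bmfunDE -linearD; apply: associated_operator_mono; exact: Linf_pnormD.
Qed.

Lemma lift_pnormZ (a : R) (v : Linf_normed M) x :
  L (Linf_pnorm (a *: v : Linf_normed M)) x = `|a| * L (Linf_pnorm (v : M)) x.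
Proof.
by rewrite Linf_pnormZ Linf_abs_alg Linf_mul_algl linearZZ.
Qed.

Definition lift_pnorm : seminorm_family X (Linf_normed M) :=
  SeminormFamily lift_pnormD lift_pnormZ.

End AssociatedOperator.

(** * Elements glued from countably many images *)

Section LiftedSpan.
Context (d : measure_display) (X : measurableType d) (R : realType).
Context (m : {measure set X -> \bar R}) (M : normedLinfModuleType m).
Context (N : normedBmfunModuleType X R).
Context (T : {linear Linf_normed M -> bm_normed N}).

(** A partition with a sequence of vectors amounts to a countably valued map, through the index of
    the block containing a point. *)
Lemma lifted_spanP (s : bm_normed N) : lifted_span T s <->
  exists2 w : X -> Linf_normed M, countably_valued w &
    forall x, bm_pnorm (s - T (w x) : N) x = 0.
Proof.
split=> [[A [v sv]]|[_ [k [v [mk /funext->]]] sw]].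
  have [k kA] := mpartition_index A; exists (v \o k).
    exists k, v; split=> // n; rewrite -kA; exact: block_measurable.
  by move=> x; have /bm_scale_indicP := sv (k x); apply; rewrite kA.
exists (fibers mk), v => n; apply/bm_scale_indicP => x <-.
exact: sw.
Qed.

Lemma lifted_span_submod_closed : submod_closed (mem (lifted_span T)).
Proof.
split.
  rewrite inE; apply/lifted_spanP; exists (fun=> 0); first exact: countably_valued_cst.
  by move=> x; rewrite linear0 subr0 bm_pnorm0.
move=> a s t; rewrite !inE => /lifted_spanP[w cw sw] /lifted_spanP[w' cw' tw'].
apply/lifted_spanP; exists (fun x => a *: w x + w' x).
  exact: (countably_valued_comp2 (fun u v => a *: u + v)).
move=> x; rewrite linearP opprD addrACA -scalerBr.
apply/eqP; rewrite eq_le bm_pnorm_ge0 andbT (le_trans (bm_pnormD _ _ _))//.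
by rewrite tw' addr0 bm_pnormZ sw mulr0.
Qed.

End LiftedSpan.

(** * Completions of a family of seminorms and their uniqueness *)

Section Completion.
Context (d : measure_display) (X : measurableType d) (R : realType).
Context (V : lmodType R) (p : seminorm_family X V).

(** Density is phrased with maps [w : X -> V] instead of elements of the span, so that approximants
    can be carried from one module to another. *)
Definition is_completion (N : normedBmfunModuleType X R)
    (T : {linear V -> bm_normed N}) :=
  (forall v, bm_pnorm (T v : N) = p v) /\
  forall (s : N) e, 0 < e -> exists2 w, countably_valued w &
    forall x, bm_pnorm (s - (T (w x) : N)) x <= e.

Section OneCompletion.
Context (N : normedBmfunModuleType X R) (T : {linear V -> bm_normed N}).
Hypothesis cT : is_completion T.

Lemma completion_dist u v x :
  bm_pnorm ((T u : N) - (T v : N)) x = p (u - v) x.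
Proof. by rewrite -cT.1 linearB. Qed.

Lemma completion_glue w (C : R) : countably_valued w ->
  (forall x, p (w x) x <= C) ->
  exists t : N, forall x, bm_pnorm (t - (T (w x) : N)) x = 0.
Proof.
move=> [k [v [mk /funext->]]] wC.
have [|t [tv _]] := bm_glueing (s := N) (fibers mk) (fun n => (T (v n) : N)).
  by apply/ereal_sup_blocksP; exists C => n x <-; rewrite cT.1; exact: wC.
by exists t => x; have /bm_scale_indicP := tv (k x); exact.
Qed.

(** This supplies the bound on [w] that [completion_glue] asks for. *)
Lemma completion_approx_bounded (s : N) w x e :
  bm_pnorm (s - (T (w x) : N)) x <= e -> p (w x) x <= sup_norm (bm_pnorm s) + e.
Proof.
move=> sw; rewrite -cT.1 -[X in bm_pnorm X](subrK s) addrC.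
rewrite (le_trans (bm_pnormD _ _ _))// bm_pnorm_distC lerD//.
by rewrite (le_trans (ler_norm _))// sup_norm_ub.
Qed.

End OneCompletion.

Lemma bm_pnorm_approxD (N : normedBmfunModuleType X R)
    (T : {linear V -> bm_normed N}) (s t : N) u v x :
  bm_pnorm (s + t - (T (u + v) : N)) x <=
  bm_pnorm (s - (T u : N)) x + bm_pnorm (t - (T v : N)) x.
Proof.
have -> : (T (u + v) : N) = (T u : N) + (T v : N) := linearD T u v.
by rewrite opprD addrACA bm_pnormD.
Qed.

(** The difference splits as [(f - a) s + a (s - T v)], which leads to a bound of the form treated
    in [mul_approx]. *)
Lemma bm_pnorm_approxZ (N : normedBmfunModuleType X R)
    (T : {linear V -> bm_normed N}) (f : bmfun X R) (s : N) a v x :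
  bm_pnorm (f *: s - (T (a *: v) : N)) x <=
  `|f x - a| * bm_pnorm s x + `|a| * bm_pnorm (s - (T v : N)) x.
Proof.
pose c := a *: (1 : bmfun X R).
have -> : (T (a *: v) : N) = c *: (T v : N) := linearZZ T a v.
have cx : c x = a by rewrite bmfunZE mulr1.
rewrite (_ : _ - _ = (f - c) *: s + c *: (s - (T v : N))); last first.
  by rewrite scalerBl scalerBr addrA subrK.
by rewrite (le_trans (bm_pnormD _ _ _))// !bm_pnormZ bmfunDE bmfunNE cx.
Qed.

Section TwoCompletions.
Context (N1 N2 : normedBmfunModuleType X R).
Context (T1 : {linear V -> bm_normed N1}) (T2 : {linear V -> bm_normed N2}).

(* The graph of the isomorphism: elements with common approximants in [V]. *)
Definition coupled (s : N1) (t : N2) := forall e, 0 < e ->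
  exists2 w, countably_valued w & forall x,
    bm_pnorm (s - (T1 (w x) : N1)) x <= e /\
    bm_pnorm (t - (T2 (w x) : N2)) x <= e.

Lemma coupledD s t s' t' : coupled s t -> coupled s' t' ->
  coupled (s + s') (t + t').
Proof.
move=> st st' e e0; have e20 : 0 < e / 2 by rewrite divr_gt0.
have [w cw wP] := st _ e20; have [w' cw' wP'] := st' _ e20.
exists (fun x => w x + w' x); first exact: (countably_valued_comp2 +%R).
move=> x; have [sw tw] := wP x; have [sw' tw'] := wP' x.
by split; rewrite (le_trans (bm_pnorm_approxD _ _ _ _ _ _))// [leRHS]splitr lerD.
Qed.

Lemma coupledZ f s t : coupled s t -> coupled (f *: s) (f *: t).
Proof.
move=> st e e0; have [B fB] := bmfun_bounded f.
(* The sum bounds both [s] and [t], so that one [h] serves in both modules. *)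
pose C := sup_norm (bm_pnorm s) + sup_norm (bm_pnorm t).
have [sC tC] : (forall x, bm_pnorm s x <= C) /\ (forall x, bm_pnorm t x <= C).
  split=> x; rewrite (le_trans (ler_norm _))// (le_trans (sup_norm_ub _ _))//.
    by rewrite lerDl sup_norm_ge0.
  by rewrite lerDr sup_norm_ge0.
have [h h0 hP] := mul_approx (le_trans (normr_ge0 _) (fB point))
  (le_trans (bm_pnorm_ge0 s point) (sC point)) e0.
have [g cg fg] := bmfun_approx f h0; have [w cw wP] := st h h0.
exists (fun x => g x *: w x); first exact: (countably_valued_comp2 *:%R).
move=> x; have [sw tw] := wP x; 
by split; apply: le_trans (bm_pnorm_approxZ _ _ _ _ _ _) _; apply: hP;
  rewrite // bm_pnorm_ge0/=.
Qed.

Lemma coupled_linear f s t s' t' : coupled s t -> coupled s' t' ->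
  coupled (f *: s + s') (f *: t + t').
Proof. by move=> st; apply: coupledD; exact: coupledZ. Qed.

Lemma coupled_diag v : coupled (T1 v) (T2 v).
Proof.
move=> e e0; exists (fun=> v); first exact: countably_valued_cst.
by move=> x; rewrite !subrr !bm_pnorm0 (ltW e0).
Qed.

Hypotheses (cT1 : is_completion T1) (cT2 : is_completion T2).

(** Through a common approximant [w], both norms are within [e / 2] of [p (w x) x]. *)
Lemma coupled_pnorm s t : coupled s t -> bm_pnorm s = bm_pnorm t.
Proof.
move=> st; apply/bmfun_eqP => x; apply/eqP; rewrite -subr_eq0 -normr_le0.
apply/ler_addgt0Pr => e e0; rewrite add0r.
have [w _ /(_ x)[sw tw]] := st _ (divr_gt0 e0 (ltr0Sn R 1)).
rewrite (le_trans (ler_distD (p (w x) x) _ _))// [leRHS]splitr lerD//.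
  by rewrite -cT1.1 (le_trans (bm_pnorm_dist_le _ _ _)).
by rewrite -cT2.1 (le_trans (bm_pnorm_dist_le _ _ _))// bm_pnorm_distC.
Qed.

(** By linearity [0] is coupled with [t' - t], which therefore has pointwise norm zero. *)
Lemma coupled_inj s t t' : coupled s t -> coupled s t' -> t = t'.
Proof.
move=> st st'; have := coupled_linear (-1) st st'; rewrite !scaleN1r addNr.
move=> /coupled_pnorm tt'; apply/esym/eqP; rewrite -subr_eq0 addrC; apply/eqP.
by apply/bm_pnorm_eq0 => x; rewrite -tt' bm_pnorm0.
Qed.

(** Approximants of [s] are glued in [N2] to elements [t n]. Distances between approximants are the
    same in both modules, so these elements form a Cauchy sequence, whose limit is coupled with
    [s]. *)
Lemma coupled_total s : exists t, coupled s t.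
Proof.
have /choice[w wP] (n : nat) : exists w, countably_valued w /\
    forall x, bm_pnorm (s - (T1 (w x) : N1)) x <= n.+1%:R^-1.
  have [|w cw sw] := cT1.2 s n.+1%:R^-1; first by rewrite invr_gt0 ltr0n.
  by exists w.
have /choice[t tP] n : exists t : N2, forall x,
    bm_pnorm (t - (T2 (w n x) : N2)) x = 0.
  apply: (completion_glue cT2 (wP n).1) => x.
  exact: completion_approx_bounded ((wP n).2 x).
have small (e : R) : 0 < e -> exists K, forall n, (K <= n)%N -> n.+1%:R^-1 <= e.
  move=> e0; have [K _ KP] := near_infty_natSinv_lt (PosNum e0).
  by exists K => n Kn; rewrite ltW//; exact: KP.
have /cvg_ex[l /bm_cvgP lt] : cvgn (t : nat -> bm_normed N2).
  apply: bm_complete; apply/bm_cauchyP => e e0.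
  have [K KP] := small _ (divr_gt0 e0 (ltr0Sn R 1)).
  exists K => i j Ki Kj x.
  rewrite (le_trans (bm_pnorm_triangle (T2 (w i x) : N2) _ _ _))// tP add0r.
  rewrite (le_trans (bm_pnorm_triangle (T2 (w j x) : N2) _ _ _))//.
  rewrite [X in _ + X]bm_pnorm_distC tP addr0 completion_dist// -(completion_dist cT1).
  rewrite (le_trans (bm_pnorm_triangle s _ _ _))// bm_pnorm_distC [leRHS]splitr.
  by rewrite lerD// (le_trans ((wP _).2 x))// KP.
exists l => e e0; have [K KP] := small e e0; have [K' KP'] := lt e e0.
pose n := maxn K K'; exists (w n); first exact: (wP n).1.
move=> x; split; first by rewrite (le_trans ((wP n).2 x))// KP// leq_maxl.
rewrite (le_trans (bm_pnorm_triangle (t n) _ _ _))// tP addr0.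
by apply: KP'; exact: leq_maxr.
Qed.

End TwoCompletions.

Lemma coupled_sym (N1 N2 : normedBmfunModuleType X R)
    (T1 : {linear V -> bm_normed N1}) (T2 : {linear V -> bm_normed N2}) s t :
  coupled T1 T2 s t -> coupled T2 T1 t s.
Proof.
by move=> st e /st[w cw sw]; exists w => // x; have [] := sw x.
Qed.

(** Each identity holds because both sides are coupled with the same element; the inverse comes from
    the symmetry of the relation. *)
Lemma completion_unique_isomorphism (N1 N2 : normedBmfunModuleType X R)
    (T1 : {linear V -> bm_normed N1}) (T2 : {linear V -> bm_normed N2}) :
  is_completion T1 -> is_completion T2 ->
  exists! Psi : N1 -> N2, pnorm_isomorphism Psi /\ forall v, Psi (T1 v) = T2 v.
Proof.
move=> cT1 cT2; have /choice[Psi PsiP] := coupled_total cT1 cT2.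
have /choice[Phi PhiP] := coupled_total cT2 cT1.
exists Psi; split.
  split=> [|v]; last first.
    by apply: (coupled_inj cT1 cT2 (PsiP (T1 v))); exact: coupled_diag.
  split=> [f s t||s].
  - apply: (coupled_inj cT1 cT2 (PsiP _)).
    exact: coupled_linear (PsiP s) (PsiP t).
  - exists Phi => s.
      by apply: (coupled_inj cT2 cT1 (PhiP _)); exact: coupled_sym.
    by apply: (coupled_inj cT1 cT2 (PsiP _)); exact: coupled_sym.
  - exact/esym/(coupled_pnorm cT1 cT2 (PsiP s)).
(* As [Psi'] is linear, preserves the norm and sends [T1 v] to [T2 v], approximants of [s] also
   approximate [Psi' s]; hence [s] and [Psi' s] are coupled. *)
move=> Psi' [[lPsi _ nPsi] PsiT]; apply/funext => s.
apply: (coupled_inj cT1 cT2 (PsiP s)) => e e0.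
have [w cw sw] := cT1.2 s e e0; exists w => // x; split=> //.
rewrite -PsiT (_ : _ - _ = Psi' (s - (T1 (w x) : N1))) ?nPsi//.
by rewrite addrC -scaleN1r -lPsi scaleN1r addrC.
Qed.

End Completion.

(** * Liftings of a module as completions *)

Section ModuleLifting.
Context (d : measure_display) (X : measurableType d) (R : realType).
Context (m : {measure set X -> \bar R}) (M : normedLinfModuleType m).
Context (ell : lifting m) (L : {linear Linf m -> bmfun X R}).
Context (ellL : associated_operator ell L).
Context (N : normedBmfunModuleType X R).
Context (T : {linear Linf_normed M -> bm_normed N}).

(** An element of the span close to [s] provides an approximant; conversely, an approximant of [s]
    is bounded and glues to an element of the span. *)
Lemma module_liftingP :
  is_module_lifting T L <-> is_completion (lift_pnorm ellL M) T.
Proof.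
split=> -[TL dT]; split=> //.
  move=> s e e0.
  have [||t [/= st /lifted_spanP[w cw tw]]] := dT (ball (s : bm_normed N) e).
  - by exists s; exact: ballxx.
  - exact: ball_open.
  exists w => // x; rewrite (le_trans (bm_pnorm_triangle t _ _ _))// tw addr0.
  move: x; apply/(@bm_norm_leP _ _ _ _ (s - t : bm_normed N)).
  by move: st; rewrite -ball_normE => /ltW.
move=> O [s Os] oO.
have /nbhs_normP[e /= e0 seO] : nbhs s O by exact: open_nbhs_nbhs.
have [w cw sw] := dT s _ (divr_gt0 e0 (ltr0Sn R 1)).
have [|t tw] := completion_glue (conj TL dT) cw
    (C := sup_norm (bm_pnorm (s : N)) + e / 2).
  by move=> x; apply: (completion_approx_bounded (conj TL dT)); exact: sw.
exists t; split; last by apply/lifted_spanP; exists w.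
apply: seO => /=; apply: (@le_lt_trans _ _ (e / 2)).
  apply/(@bm_norm_leP _ _ _ _ (s - t : bm_normed N)) => x.
  rewrite (le_trans (bm_pnorm_triangle (T (w x) : N) _ _ _))//.
  by rewrite [X in _ + X]bm_pnorm_distC tw addr0.
by rewrite ltr_pdivrMr// ltr_pMr// ltr1n.
Qed.

End ModuleLifting.

(** * Constant sections and the existence of the lifting *)

Section ConstantSections.
Context (d : measure_display) (X : measurableType d) (R : realType).
Context (V : lmodType R) (p : seminorm_family X V).

Lemma cst_section_subproof v : (fun x => germ p x v) \in section_pred p.
Proof.
apply: (germ_section (w := fun=> v) (C := sup_norm (p v))).
  exact: countably_valued_cst.
by move=> x; rewrite (le_trans (ler_norm _))// sup_norm_ub.
Qed.

Definition cst_section v : bm_normed (msection p) :=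
  MSection (cst_section_subproof v).

Lemma cst_section_linear : linear cst_section.
Proof.
move=> a u v; apply/(@msection_eqP _ _ _ _ p) => x phi /=.
rewrite germD germZ; congr (_ + _); congr (_ * _).
(* The scalar [a] acts as the constant function [a *: 1], whose values are [a * 1]. *)
exact/esym/mulr1.
Qed.

HB.instance Definition _ := GRing.isLinear.Build R V (bm_normed (msection p)) _
  cst_section cst_section_linear.

Lemma cst_section_completion : is_completion p cst_section.
Proof.
split=> [v|s e e0]; first by apply/bmfun_eqP => x; exact: section_norm_germ.
have [w cw sw] := msection_approx s e0; exists w => // x.
by apply/msection_dist_leP => phi; exact: sw.
Qed.

End ConstantSections.

Theorem theorem3p5 (d : measure_display) (X : measurableType d) (R : realType)
    (m : {measure set X -> \bar R})
    (measurable_set1X : forall x : X, measurable [set x])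
    (sigma_finite_m : sigma_finite [set: X] m)
    (M : normedLinfModuleType m)
    (ell : lifting m) (L : {linear Linf m -> bmfun X R})
    (ellL : associated_operator ell L) :
  exists (Mbar : normedBmfunModuleType X R)
         (LL : {linear Linf_normed M -> bm_normed Mbar}),
    [/\ is_module_lifting LL L,
        submod_closed (mem (lifted_span LL)) &
        forall (Nbar : normedBmfunModuleType X R)
               (LL' : {linear Linf_normed M -> bm_normed Nbar}),
          is_module_lifting LL' L ->
          exists! Psi : Mbar -> Nbar,
            pnorm_isomorphism Psi /\ forall v : M, Psi (LL v) = LL' v].
Proof.
pose p := lift_pnorm ellL M.
exists (msection p : normedBmfunModuleType X R), (@cst_section _ _ _ _ p).
have cp := cst_section_completion p.
split.
- exact/(module_liftingP ellL).
- exact: lifted_span_submod_closed.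
- move=> Nbar LL' /(module_liftingP ellL) cLL'.
  exact: completion_unique_isomorphism cp cLL'.
Qed.
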